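(* Let $I\subseteq R=k[x_1,\ldots,x_n]$ be a squarefree monomial ideal and let $\Delta$ be a simplicial complex on the vertex set $[n]$ such that $I_\Delta=I$. The following are equivalent: (i) $I$ is a tame ideal. (ii) For any two distinct facets $F,G$ of $\Delta$, one has $F\cup G=[n]$.
   Context: Let $k$ be an algebraically closed field and $R=k[x_1,\ldots,x_n]$. For an ideal $I\subseteq R$, the blowup of $\mathbb{A}^n_k=\mathrm{Spec}(R)$ along $I$ is $\mathrm{Bl}_I(R)=\mathrm{Proj}\big(\bigoplus_{i\ge 0}I^it^i\big)$, and $I$ is called tame if $\mathrm{Bl}_I(R)$ is regular. A simplicial complex $\Delta$ on $[n]=\{1,\ldots,n\}$ is a collection of subsets of $[n]$ (its faces) such that $\{i\}\in\Delta$ for all $i\in[n]$, and every subset of a face (including the empty set) is a face. Facets are the faces maximal under inclusion. The Stanley–Reisner ideal $I_\Delta\subseteq R$ is the ideal generated by the monomials $\mathbf{x}_F=\prod_{i\in F}x_i$ for all $F\subseteq[n]$ with $F\notin\Delta$. *)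

(* Defs.v *)
From HB Require Import structures.
From mathcomp Require Import all_boot all_order all_algebra.
From mathcomp Require Import boolp.
From mathcomp Require Import mpoly.

Set Implicit Arguments.
Unset Strict Implicit.
Unset Printing Implicit Defensive.

Import GRing.Theory.
Local Open Scope ring_scope.

(* Arbitrary subsets of a ring A are represented by {pred A}; by boolp's
   [asbool] (written `[< P >]) this is no restriction compared to A -> Prop.
   In MathComp, [idealr_closed J] includes that J is proper, and
   [prime_idealr A] is the type of (proper) prime ideals of A. *)

Section Ideals.
Variable A : comNzRingType.
Implicit Types (X J : {pred A}).

Definition gen_ideal X : {pred A} :=
  fun y => `[< exists2 s : seq (A * A), {in s, forall p, p.2 \in X}
                                      & y = \sum_(p <- s) p.1 * p.2 >].

(* For i = 0 the empty product is 1, so the 0-th power is the whole ring. *)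
Definition ideal_exp J (i : nat) : {pred A} :=
  gen_ideal (fun y => `[< exists2 a : 'I_i -> A, (forall j, a j \in J)
                                               & y = \prod_j a j >]).

Lemma mem_gen_ideal X x : x \in X -> x \in gen_ideal X.
Proof.
move=> Xx; apply/asboolP; exists [:: (1, x)].
  by move=> p; rewrite inE => /eqP->.
by rewrite big_seq1 mul1r.
Qed.

Lemma gen_ideal0 X : 0 \in gen_ideal X.
Proof. by apply/asboolP; exists [::]; rewrite ?big_nil. Qed.

Lemma gen_idealD X : {in gen_ideal X &, forall x y, x + y \in gen_ideal X}.
Proof.
move=> x y /asboolP[s Xs ->] /asboolP[t Xt ->]; apply/asboolP.
exists (s ++ t); last by rewrite big_cat.
by move=> p; rewrite mem_cat => /orP[/Xs|/Xt].
Qed.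

Lemma gen_idealMl X a : {in gen_ideal X, forall x, a * x \in gen_ideal X}.
Proof.
move=> x /asboolP[s Xs ->]; apply/asboolP.
exists [seq (a * p.1, p.2) | p <- s].
  by move=> _ /mapP[p /Xs Xp ->].
by rewrite big_map mulr_sumr; apply: eq_bigr => p _; rewrite mulrA.
Qed.

Lemma gen_idealN X : {in gen_ideal X, forall x, - x \in gen_ideal X}.
Proof. by move=> x Xx; rewrite -mulN1r gen_idealMl. Qed.

Lemma gen_ideal_sum X (T : Type) (r : seq T) (P : pred T) (F : T -> A) :
  (forall i, P i -> F i \in gen_ideal X) ->
  \sum_(i <- r | P i) F i \in gen_ideal X.
Proof.
by move=> XF; elim/big_ind: _ => //; [exact: gen_ideal0 | exact: gen_idealD].
Qed.

Lemma ideal_expM J i j x y : x \in ideal_exp J i -> y \in ideal_exp J j ->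
  x * y \in ideal_exp J (i + j).
Proof.
move=> /asboolP[s Js ->] /asboolP[t Jt ->].
rewrite big_seq mulr_suml; apply: gen_ideal_sum => p /Js/asboolP[a Ja ->].
rewrite [X in _ * X]big_seq mulr_sumr; apply: gen_ideal_sum => q /Jt/asboolP[b Jb ->].
rewrite mulrACA; apply/gen_idealMl/mem_gen_ideal/asboolP.
exists (fun l => match split l with inl u => a u | inr v => b v end).
  by move=> l; case: (split l).
rewrite big_split_ord /=; congr (_ * _); apply: eq_bigr => l _.
  by rewrite (unsplitK (inl l)).
by rewrite (unsplitK (inr l)).
Qed.

Lemma ideal_exp0 J x : x \in ideal_exp J 0.
Proof.
rewrite -[x]mulr1; apply/gen_idealMl/mem_gen_ideal/asboolP.
by exists (fun=> 0) => [[]|]; rewrite ?big_ord0.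
Qed.

End Ideals.

Section RegularLocal.
Variable A : comNzRingType.
Implicit Types (J m : {pred A}).

Definition is_ideal J : Prop :=
  0 \in J /\ forall a, {in J &, forall u v, a * u + v \in J}.

Definition noetherian : Prop :=
  forall J, is_ideal J -> exists s : seq A, J =i gen_ideal (mem s).

Definition maximal_ideal m : Prop :=
  idealr_closed m /\
  forall J, idealr_closed J -> {subset m <= J} -> {subset J <= m}.

Definition prime_chain (d : nat) (c : 'I_d.+1 -> prime_idealr A) : Prop :=
  forall i j : 'I_d.+1, (i < j)%N ->
    {subset (c i : {pred A}) <= (c j : {pred A})} /\
    ~ {subset (c j : {pred A}) <= (c i : {pred A})}.

Definition krull_dim (d : nat) : Prop :=
  (exists c, @prime_chain d c) /\
  (forall e, (exists c, @prime_chain e c) -> (e <= d)%N).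

(* A Noetherian local ring (A, m) whose maximal ideal m is generated by dim A
   elements. *)
Definition regular_local : Prop :=
  noetherian /\
  exists m : {pred A},
    [/\ maximal_ideal m,
        forall m', maximal_ideal m' -> m' =i m
      & exists2 d, krull_dim d
                 & exists2 s : seq A, size s = d & m =i gen_ideal (mem s)].

End RegularLocal.

(* The Rees algebra, as the subring of all f = \sum_i f_i t^i in R[t] such
    that f_i \in I^i for all i *)

Section Rees.
Variables (R : comNzRingType) (I : {pred R}).

Definition rees_pred : {pred {poly R}} :=
  fun f => `[< forall i, f`_i \in ideal_exp I i >].

Lemma rees_predP (f : {poly R}) :
  reflect (forall i, f`_i \in ideal_exp I i) (f \in rees_pred).
Proof. exact: asboolP. Qed.

Lemma rees_subring_closed : subring_closed rees_pred.
Proof.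
split=> [|f g /rees_predP If /rees_predP Ig|f g /rees_predP If /rees_predP Ig];
  apply/rees_predP => i.
- by rewrite coef1; case: i => [|i]; rewrite ?ideal_exp0 ?gen_ideal0.
- by rewrite coefB gen_idealD ?gen_idealN.
rewrite coefM; apply: gen_ideal_sum => j _.
by have := ideal_expM (If j) (Ig (i - j)%N); rewrite subnKC ?leq_ord.
Qed.

HB.instance Definition _ :=
  GRing.isSubringClosed.Build {poly R} rees_pred rees_subring_closed.

Record rees := Rees { rees_val :> {poly R}; _ : rees_val \in rees_pred }.

HB.instance Definition _ := [isSub for rees_val].
HB.instance Definition _ := [Choice of rees by <:].
HB.instance Definition _ := [SubChoice_isSubComNzRing of rees by <:].

Lemma reesP (f : rees) i : (f : {poly R})`_i \in ideal_exp I i.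
Proof. by case: f => f /= /rees_predP. Qed.

Lemma rees_val1 : rees_val 1 = 1.
Proof. by []. Qed.

Lemma rees_valM (f g : rees) : rees_val (f * g) = rees_val f * rees_val g.
Proof. by []. Qed.

Lemma rees_valB (f g : rees) : rees_val (f - g) = rees_val f - rees_val g.
Proof. by []. Qed.

Lemma rees_comp_subproof (d : nat) (f : rees) :
  (f : {poly R})`_d *: 'X^d \in rees_pred.
Proof.
apply/rees_predP => i; rewrite coefZ coefXn.
by have [->|_] := eqVneq; rewrite ?mulr1 ?mulr0 ?reesP ?gen_ideal0.
Qed.

Definition rees_comp (d : nat) (f : rees) : rees := Rees (rees_comp_subproof d f).

Definition rees_homog (d : nat) (f : rees) : Prop := rees_comp d f = f.

Definition homog_ideal (P : {pred rees}) : Prop :=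
  forall f d, f \in P -> rees_comp d f \in P.

Definition irrelevant : {pred rees} := fun f => rees_comp 0 f == 0.

End Rees.

(* The blowup Proj(rees I): its points are the homogeneous prime ideals P of
    rees I not containing the irrelevant ideal, and its stalk at P is the
    homogeneous localization (rees I)_(P), the ring of fractions a / s with a, s
    homogeneous of the same degree and s \notin P. As rees I is a subring of the
    domain R[t], this localization is realized as a subring of Frac(R[t]). *)

Section Blowup.
Variables (R : idomainType) (I : {pred R}).

Record blowup := Blowup {
  pt_ideal :> prime_idealr (rees I);
  pt_homog : homog_ideal pt_ideal;
  pt_relevant : ~ {subset irrelevant (I := I) <= (pt_ideal : {pred rees I})}
}.

Section Stalk.
Variable P : blowup.

Definition stalk_pred : {pred {fraction {poly R}}} :=
  fun z => `[< exists d : nat, exists a s : rees I,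
    [/\ rees_homog d a, rees_homog d s, s \notin (P : {pred rees I})
      & z = FracField.tofrac (a : {poly R}) / FracField.tofrac (s : {poly R})] >].

Lemma rees_homogE d (f : rees I) :
  rees_homog d f <-> (f : {poly R}) = (f : {poly R})`_d *: 'X^d.
Proof.
split=> [{1}<- //|E]; apply: val_inj; exact: esym E.
Qed.

Lemma rees_homogM d e (f g : rees I) :
  rees_homog d f -> rees_homog e g -> rees_homog (d + e) (f * g).
Proof.
move=> /rees_homogE Ef /rees_homogE Eg; apply/rees_homogE.
rewrite rees_valM Ef Eg -scalerAl -scalerAr scalerA -exprD.
by rewrite coefZ coefXn eqxx mulr1.
Qed.

Lemma rees_homogB d (f g : rees I) :
  rees_homog d f -> rees_homog d g -> rees_homog d (f - g).
Proof.
move=> /rees_homogE Ef /rees_homogE Eg; apply/rees_homogE.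
by rewrite rees_valB coefB scalerBl -Ef -Eg.
Qed.

Lemma rees_homog1 : rees_homog 0 (1 : rees I).
Proof.
by apply/rees_homogE; rewrite rees_val1 coef1 expr0 scale1r.
Qed.

Lemma stalk_subring_closed : subring_closed stalk_pred.
Proof.
have nz (s : rees I) : s \notin (P : {pred rees I}) ->
    FracField.tofrac (s : {poly R}) != 0.
  apply: contra; rewrite tofrac_eq0 => /eqP s0.
  by rewrite (_ : s = 0) ?idealr0 //; apply: val_inj.
split.
- apply/asboolP; exists 0%N, 1, 1; split; rewrite ?idealr1 //.
  + exact: rees_homog1.
  + exact: rees_homog1.
  by rewrite tofrac1 divr1.
- move=> _ _ /asboolP[d [a [s [ha hs Ps ->]]]] /asboolP[e [b [t [hb ht Pt ->]]]].
  apply/asboolP; exists (d + e)%N, (a * t - s * b), (s * t); split.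
  + by apply: rees_homogB; apply: rees_homogM.
  + exact: rees_homogM.
  + by rewrite prime_idealrM negb_or Ps.
  rewrite rees_valB !rees_valM tofracB !tofracM.
  rewrite -[- (_ / _)]mulNr addf_div ?nz // mulNr.
  by congr ((_ - _) / _); apply: mulrC.
move=> _ _ /asboolP[d [a [s [ha hs Ps ->]]]] /asboolP[e [b [t [hb ht Pt ->]]]].
apply/asboolP; exists (d + e)%N, (a * b), (s * t); split.
- exact: rees_homogM.
- exact: rees_homogM.
- by rewrite prime_idealrM negb_or Ps.
rewrite !rees_valM !tofracM.
by rewrite mulf_div.
Qed.

HB.instance Definition _ :=
  GRing.isSubringClosed.Build {fraction {poly R}} stalk_pred stalk_subring_closed.

Record stalk := Stalk {
  stalk_val :> {fraction {poly R}};
  _ : stalk_val \in stalk_pred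
}.

HB.instance Definition _ := [isSub for stalk_val].
HB.instance Definition _ := [Choice of stalk by <:].
HB.instance Definition _ := [SubChoice_isSubComNzRing of stalk by <:].

End Stalk.

(* The ideal I is tame if the scheme Proj(rees I) is regular, i.e. if all its
   local rings are regular. For R = k[x_1, ..., x_n] this scheme is of finite
   type over k, so that being locally Noetherian need not be required. *)
Definition tame : Prop := forall P : blowup, regular_local (stalk P).

End Blowup.

Definition simplicial_complex (n : nat) (D : {set {set 'I_n}}) : Prop :=
  [/\ forall i, [set i] \in D, set0 \in D
    & forall F G : {set 'I_n}, F \in D -> G \subset F -> G \in D].

Definition facet (n : nat) (D : {set {set 'I_n}}) (F : {set 'I_n}) : bool :=
  maxset (fun G => G \in D) F.

Definition stanley_reisner (k : fieldType) (n : nat) (D : {set {set 'I_n}}) :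
    {pred {mpoly k[n]}} :=
  gen_ideal (fun f => `[< exists2 F : {set 'I_n}, F \notin D
                                               & f = \prod_(i in F) 'X_i >]).
Arguments stanley_reisner k {n} D _.

Definition squarefree_monomial_ideal (k : fieldType) (n : nat)
    (I : {pred {mpoly k[n]}}) : Prop :=
  exists2 M : {pred 'X_{1..n}}, forall m, m \in M -> forall i, (m i <= 1)%N
    & I =i gen_ideal (fun f => `[< exists2 m, m \in M & f = 'X_[m] >]).

(* Main.v *)
(** Let C_F be the complement of the facet F, so that I is the intersection of the
    prime ideals (x_i : i in C_F), and the generators of I are the minimal
    transversals N of the sets C_F.

    If the C_F are pairwise disjoint, then every point of the blowup lies on the
    chart of some minimal generator x_N, which is an affine n-space: its
    coordinates are x_i / x_j for i, j in the same C_F with j in N, and x_i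
    otherwise. The local rings of a polynomial ring at arbitrary primes are regular,
    which is shown by adjoining one variable at a time; the upper bound on their
    dimension comes from counting algebraically independent elements.

    Conversely, x_N is a vertex of the Newton polyhedron of I, so the chart of x_N
    contains a point at which the indecomposable monomials of the chart are
    linearly independent in the cotangent space. The local ring there has dimension
    at most n, so regularity allows at most n of them. They include n obvious
    ones, one for each variable, and the absence of others is an exchange property
    of the minimal nonfaces: they are the bases of a matroid in which every
    fundamental circuit has at most two elements. Its parallel classes are the C_F,
    which are therefore disjoint. *)

From HB Require Import structures.
Require Import Defs.
From mathcomp Require Import all_boot all_order all_algebra.
From mathcomp Require Import boolp ring zify.
From mathcomp Require Import mpoly.

Set Implicit Arguments.
Unset Strict Implicit.
Unset Printing Implicit Defensive.

Import GRing.Theory.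
Local Open Scope ring_scope.

(** * Noetherian rings *)

(** All dimension bounds rest on one observation: a strict inclusion of primes costs one degree of
    transcendence. An element that enters at a step of a chain is independent, modulo the lower
    prime, of any elements independent modulo the upper one. So a chain of length e with r elements
    independent modulo its top yields e + r independent elements of a ring inside Frac R, and e + r
    <= n.

    For the converse, independence in the cotangent space is detected by reading coefficients. If a
    product of a monomial of I^d and a monomial of I^e is x_N^(d+e), both are powers of x_N; hence
    the coefficient of x_N^d in degree d is multiplicative and defines a point, with values in k.
    For an indecomposable monomial w / x_N of the chart, the coefficient of x_N^d w in degree d + 1
    obeys the Leibniz rule, so it induces a linear form on the cotangent space; the forms of
    distinct w are dual to the monomials themselves. Only the bound dim <= n is needed at this
    point, not the exact dimension. *)

Section GenIdeal.
Variable A : comNzRingType.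

Lemma gen_ideal_is_ideal (X : {pred A}) : is_ideal (gen_ideal X).
Proof.
split=> [|a u v Xu Xv]; first exact: gen_ideal0.
by rewrite gen_idealD ?gen_idealMl.
Qed.

Lemma gen_ideal_sub (X J : {pred A}) :
  is_ideal J -> {subset X <= J} -> {subset gen_ideal X <= J}.
Proof.
move=> [J0 JL] XJ y /asboolP[s Xs ->]; rewrite big_seq.
elim/big_rec: _ => [//|p x ps Jx]; exact: JL (XJ _ (Xs _ ps)) Jx.
Qed.

Lemma mem_gen_seq (s : seq A) x : x \in s -> x \in gen_ideal (mem s).
Proof. by move=> sx; apply: mem_gen_ideal. Qed.

Lemma gen_ideal_subseq (s t : seq A) x :
  {subset s <= t} -> x \in gen_ideal (mem s) -> x \in gen_ideal (mem t).
Proof.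
move=> st; apply: gen_ideal_sub; first exact: gen_ideal_is_ideal.
by move=> y sy; apply: mem_gen_seq; apply: st.
Qed.

Lemma gen_ideal_seqP (s : seq A) x : x \in gen_ideal (mem s) ->
  exists h : 'I_(size s) -> A, x = \sum_i h i * s`_i.
Proof.
pose J : {pred A} := fun x =>
  `[< exists h : 'I_(size s) -> A, x = \sum_i h i * s`_i >].
suff : {subset gen_ideal (mem s) <= J} by move=> /(_ x) H /H/asboolP.
apply: gen_ideal_sub.
  split=> [|a u v /asboolP[f ->] /asboolP[g ->]]; apply/asboolP.
    by exists (fun=> 0); rewrite big1 // => i _; rewrite mul0r.
  exists (fun i => a * f i + g i); rewrite mulr_sumr -big_split.
  by apply: eq_bigr => i _; rewrite mulrDl mulrA.
move=> y sy; apply/asboolP; have iy : (index y s < size s)%N by rewrite index_mem.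
exists (fun i => (i == Ordinal iy)%:R);
  rewrite (bigD1 (Ordinal iy)) //= eqxx mul1r nth_index //.
by rewrite big1 ?addr0 // => i /negPf->; rewrite mul0r.
Qed.

Lemma gen_ideal_rmorph (B : comNzRingType) (f : {rmorphism A -> B}) (s : seq A) x :
  x \in gen_ideal (mem s) -> f x \in gen_ideal (mem (map f s)).
Proof.
move=> /asboolP[t st ->]; rewrite rmorph_sum big_seq; apply: gen_ideal_sum => p pt.
rewrite rmorphM; apply/gen_idealMl/mem_gen_ideal; exact: map_f (st _ pt).
Qed.

End GenIdeal.

Section Noetherian.

Lemma noetherian_field (k : fieldType) : noetherian k.
Proof.
move=> J [J0 JL].
case: (pselect (exists2 x, x \in J & x != 0)) => [[x Jx x0]|nJ].
  exists [:: 1] => y; apply/idP/idP => [_|_].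
    by rewrite -[y]mulr1; apply/gen_idealMl/mem_gen_ideal; rewrite inE.
  by rewrite -[y](mulfVK x0) -[_ * _]addr0 JL.
exists [::] => y; apply/idP/idP => [Jy|].
  have [->|y0] := eqVneq y 0; first exact: gen_ideal0.
  by case: nJ; exists y.
by apply: gen_ideal_sub.
Qed.

(** Every b is associated to some [h a], so an ideal of B is generated by its contraction to S. With
    denominators 1 this also covers surjections. *)
Lemma noetherian_loc (S B : comNzRingType) (h : {rmorphism S -> B}) :
    (forall b, exists a s s', h s * s' = 1 /\ b * h s = h a) ->
  noetherian S -> noetherian B.
Proof.
move=> hB nS J [J0 JL].
have [|t Et] := nS [pred a | h a \in J].
  split=> [|a u v]; rewrite !inE ?rmorph0 // => Ju Jv.
  by rewrite rmorphD rmorphM JL.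
exists (map h t) => b; apply/idP/idP => [Jb|].
  have [a [s [s' [ss' E]]]] := hB b.
  have Ja : a \in gen_ideal (mem t).
    by rewrite -Et inE -E mulrC -[_ * _]addr0 JL.
  rewrite -[b]mulr1 -ss' mulrA E mulrC; exact/gen_idealMl/gen_ideal_rmorph.
apply: gen_ideal_sub => // _ /mapP[a at_ ->].
have : a \in gen_ideal (mem t) by apply: mem_gen_ideal.
by rewrite -Et.
Qed.

(** Hilbert's basis theorem. The ideals [L d] of coefficients in degree d increase with d;
    generators of their union already lie in some [L D], so generators of J are needed only up to
    degree D. *)
Lemma noetherian_poly (A : comNzRingType) : noetherian A -> noetherian {poly A}.
Proof.
move=> nA J JI; have [J0 JL] := JI.
(* The coefficient [a] may be 0, which makes [L d] an ideal. *)
pose has_top d a (p : {poly A}) := [/\ p \in J, (size p <= d.+1)%N & p`_d = a].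
pose L d : {pred A} := fun a => `[< exists p, has_top d a p >].
have shift d e p : p \in J -> (size p <= d.+1)%N -> (d <= e)%N ->
    has_top e p`_d (p * 'X^(e - d)).
  move=> Jp sp de; split.
  - by rewrite mulrC -[_ * _]addr0 JL.
  - apply: leq_trans (size_polyMleq _ _) _; rewrite size_polyXn addnS /=.
    by apply: leq_trans (leq_add sp (leqnn _)) _; rewrite addSn subnKC.
  by rewrite coefMXn ltnNge leq_subr /= subKn.
have Lideal d : is_ideal (L d).
  split=> [|a u v /asboolP[p [Jp sp <-]] /asboolP[q [Jq sq <-]]]; apply/asboolP.
    by exists 0; split; rewrite ?size_poly0 ?coef0.
  exists (a%:P * p + q); split; last by rewrite coefD coefCM.
    exact: JL.
  apply: leq_trans (size_polyD _ _) _; rewrite geq_max sq andbT.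
  by rewrite mul_polyC (leq_trans (size_scale_leq _ _)).
have Lmono d e : (d <= e)%N -> {subset L d <= L e}.
  by move=> de a /asboolP[p [Jp sp <-]]; apply/asboolP; eexists; apply: shift.
pose Linf : {pred A} := fun a => `[< exists d, a \in L d >].
have Linf_ideal : is_ideal Linf.
  split=> [|a u v /asboolP[d Lu] /asboolP[e Lv]]; apply/asboolP.
    by exists 0%N; case: (Lideal 0%N).
  exists (maxn d e); case: (Lideal (maxn d e)) => _; apply.
    by apply: Lmono Lu; apply: leq_maxl.
  by apply: Lmono Lv; apply: leq_maxr.
have [s Es] := nA _ Linf_ideal.
have [D sD] : exists D, {subset s <= L D}.
  have : {subset s <= Linf} by move=> a sa; rewrite Es; apply: mem_gen_ideal.
  elim: s {Es} => [|a s IH] sL; first by exists 0%N.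
  have /asboolP[d La] : a \in Linf by apply: sL; rewrite mem_head.
  have [|D sD] := IH; first by move=> b sb; apply: sL; rewrite inE sb orbT.
  exists (maxn d D) => b; rewrite inE => /orP[/eqP->|/sD].
    by apply: Lmono La; apply: leq_maxl.
  by apply: Lmono; apply: leq_maxr.
have LD e : (D <= e)%N -> {subset L e <= gen_ideal (mem s)}.
  by move=> De a La; rewrite -Es; apply/asboolP; exists e.
have /choice[S /all_and2[SL LS]] : forall d, exists t : seq A,
    {subset t <= L d} /\ {subset L d <= gen_ideal (mem t)}.
  move=> d; have [t Et] := nA _ (Lideal d); exists t; split=> a; last by rewrite Et.
  by move=> ta; rewrite Et; apply: mem_gen_ideal.
have /choice[G hG] : forall d, exists g : A -> {poly A},
    forall a, a \in L d -> has_top d a (g a).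
  move=> d; have /choice[g hg] : forall a, exists p, a \in L d -> has_top d a p.
    move=> a; have [/asboolP[p ?]|nL] := boolP (a \in L d); first by exists p.
    by exists 0.
  by exists g.
pose t := [seq G D a | a <- s] ++ flatten [seq [seq G d a | a <- S d] | d <- iota
  0 D].
have tJ : {subset t <= J}.
  move=> p; rewrite mem_cat => /orP[/mapP[a sa ->]|].
    by have [] := hG _ _ (sD _ sa).
  by move=> /flatten_mapP[d _ /mapP[a /SL/hG[Jp _ _] ->]].
have comb d (s' : seq A) (F : A -> {poly A}) : {in s', forall a,
  has_top d a (F a)} ->
    {in s', forall a, F a \in gen_ideal (mem t)} ->
  {in gen_ideal (mem s'), forall a,
    exists2 q, q \in gen_ideal (mem t) & has_top d a q}.
  move=> Ftop Fs' _ /asboolP[r rs' ->].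
  exists (\sum_(p <- r) p.1%:P * F p.2).
    by rewrite big_seq; apply: gen_ideal_sum => p /rs' ps; rewrite gen_idealMl ?Fs'.
  rewrite big_seq [X in has_top _ _ X]big_seq.
  elim/big_rec2: _ => [|p x y pr [Jy sy yd]].
    by split; rewrite ?size_poly0 ?coef0.
  have [JF sF Fd] := Ftop _ (rs' _ pr).
  split; first exact: JL.
    apply: leq_trans (size_polyD _ _) _; rewrite geq_max sy andbT.
    by rewrite mul_polyC (leq_trans (size_scale_leq _ _)).
  by rewrite coefD coefCM Fd yd.
have step p : p \in J -> p != 0 -> exists2 q, q \in gen_ideal (mem t)
    & has_top (size p).-1 (lead_coef p) q.
  move=> Jp p0; set d := (size p).-1.
  have La : lead_coef p \in L d.
    by apply/asboolP; exists p; split; rewrite // /d prednK ?size_poly_gt0.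
  case: (leqP D d) => [Dd|dD].
    refine (comb d s (fun a => G D a * 'X^(d - D)) _ _ _ (LD d Dd _ La)).
      move=> a /sD /hG[JG sG E]; rewrite -[X in has_top _ X _]E; exact: shift.
    move=> a sa; rewrite mulrC; apply/gen_idealMl/mem_gen_seq.
    by rewrite mem_cat map_f.
  refine (comb d (S d) (G d) _ _ _ (LS _ _ La)); first by move=> a /SL /hG.
  move=> a sa; apply/mem_gen_seq; rewrite mem_cat; apply/orP; right.
  by apply/flatten_mapP; exists d; rewrite ?mem_iota // map_f.
exists t => p; apply/idP/idP; last exact: gen_ideal_sub tJ _.
have [N] := ubnP (size p); elim: N p => // N IH p; rewrite ltnS => sp Jp.
have [->|p0] := eqVneq p 0; first exact: gen_ideal0.
have [q tq [Jq sq qd]] := step p Jp p0.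
rewrite -[p](subrK q) gen_idealD //; apply: IH; last first.
  by rewrite -mulN1r addrC JL.
have sp0 : (0 < size p)%N by rewrite size_poly_gt0.
apply: leq_trans sp; rewrite -[X in (_ < X)%N](prednK sp0) ltnS.
apply/leq_sizeP => j; rewrite leq_eqVlt => /orP[/eqP<-|dj].
  by rewrite coefB qd subrr.
rewrite coefB !nth_default ?subr0 //; first exact: leq_trans sq _.
by rewrite (prednK sp0) in dj.
Qed.

End Noetherian.

(** * Chains of primes and algebraic independence *)

Lemma mpoly_rmorph_eq (R : comNzRingType) (n : nat) (S : comNzRingType)
    (f g : {rmorphism {mpoly R[n]} -> S}) :
    (forall c, f c%:MP = g c%:MP) -> (forall i, f 'X_i = g 'X_i) -> f =1 g.
Proof.
move=> fgC fgX p; elim/mpolyind: p => [|c m p _ _ IH]; first by rewrite !rmorph0.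
rewrite !rmorphD IH -mul_mpolyC !rmorphM fgC mpolyXE_id !rmorph_prod.
by congr (_ * _ + _); apply: eq_bigr => i _; rewrite !rmorphXn fgX.
Qed.

Lemma poly_rmorph_eq (R S : comNzRingType) (f g : {rmorphism {poly R} -> S}) :
    (forall c, f c%:P = g c%:P) -> f 'X = g 'X -> f =1 g.
Proof.
move=> fgC fgX p; elim/poly_ind: p => [|p c IH]; first by rewrite !rmorph0.
by rewrite !rmorphD !rmorphM IH fgC fgX.
Qed.

Lemma mpoly0_const (R : comNzRingType) (p : {mpoly R[0]}) : p = (p@_0)%:MP.
Proof.
apply/mpolyP => m; rewrite mcoeffC (_ : m = 0%MM) ?eqxx ?mulr1 //.
by apply/mnmP => -[].
Qed.

(** * Splitting off the last variable *)

Section Muni.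
Variables (R : comNzRingType) (n : nat).

Lemma muni_max : muni ('X_ord_max : {mpoly R[n.+1]}) = 'X.
Proof.
rewrite muniE msuppX big_seq1 mcoeffX eqxx scale1r mnm1E eqxx.
rewrite (_ : [multinom _ | i < n] = 0%MM) ?mpolyX0 ?scale1r //.
apply/mnmP => i; rewrite mnmE mnm0E mnm1E -val_eqE /=.
by rewrite gtn_eqF.
Qed.

Lemma muni_widen (i : 'I_n) :
  muni ('X_(widen_ord (leqnSn n) i) : {mpoly R[n.+1]}) = ('X_i)%:P.
Proof.
rewrite muniE msuppX big_seq1 mcoeffX eqxx scale1r mnm1E -val_eqE /= ltn_eqF //.
rewrite expr0 alg_polyC; congr ('X_[_])%:P.
by apply/mnmP => j; rewrite mnmE !mnm1E -!val_eqE.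
Qed.

Definition muni_inv (p : {poly {mpoly R[n]}}) : {mpoly R[n.+1]} :=
  (map_poly (@mwiden n R) p).['X_ord_max].

Lemma muni_inv_zmod : zmod_morphism muni_inv.
Proof. by move=> p q; rewrite /muni_inv rmorphB hornerD hornerN. Qed.

Lemma muni_inv_monoid : monoid_morphism muni_inv.
Proof. by split=> [|p q];
  rewrite /muni_inv ?rmorph1 ?hornerC // rmorphM hornerM. Qed.

HB.instance Definition _ := GRing.isZmodMorphism.Build _ _ muni_inv muni_inv_zmod.
HB.instance Definition _ := GRing.isMonoidMorphism.Build _ _ muni_inv
  muni_inv_monoid.

Lemma muniK : cancel (@muni n R) muni_inv.
Proof.
move=> p; apply: (mpoly_rmorph_eq (f := muni_inv \o @muni n R) (g := idfun)) =>
  [c|i] /=.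
  by rewrite muniC /muni_inv map_polyC hornerC /= mwidenC.
case: (unliftP ord_max i) => [j|] ->; last first.
  by rewrite muni_max /muni_inv map_polyX hornerX.
rewrite (_ : lift _ _ = widen_ord (leqnSn n) j); last first.
  by apply: val_inj; exact: lift_max.
by rewrite muni_widen /muni_inv map_polyC hornerC /= mwidenX mnmwiden1.
Qed.

Lemma muni_invK : cancel muni_inv (@muni n R).
Proof.
move=> p; apply: (poly_rmorph_eq (f := @muni n R \o muni_inv) (g := idfun)) =>
  [c|] /=.
  apply: (mpoly_rmorph_eq (f := @muni n R \o (muni_inv \o polyC)) (g := polyC))
    => [c'|i] /=.
    by rewrite /muni_inv map_polyC hornerC /= mwidenC muniC.
  rewrite /muni_inv map_polyC hornerC /= mwidenX mnmwiden1.
  exact: muni_widen.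
by rewrite /muni_inv map_polyX hornerX muni_max.
Qed.

Lemma muni_inj : injective (@muni n R).
Proof. exact: can_inj muniK. Qed.

Lemma mmap_muni (S : comNzRingType) (f : {rmorphism R -> S}) (h : 'I_n.+1 -> S) p :
  mmap f h p =
  (map_poly (mmap f (fun i => h (widen_ord (leqnSn n) i))) (muni p)).[h ord_max].
Proof.
set g := map_poly _.
apply: (mpoly_rmorph_eq (f := mmap f h)
  (g := horner_eval (h ord_max) \o (g \o @muni n R))) => [c|i] /=.
  by rewrite mmapC muniC /g map_polyC /horner_eval hornerC /= mmapC.
rewrite mmapX mmap1U /horner_eval.
case: (unliftP ord_max i) => [j|] ->; last by rewrite muni_max /g map_polyX hornerX.
rewrite (_ : lift _ _ = widen_ord (leqnSn n) j); last first.
  by apply: val_inj; exact: lift_max.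
by rewrite muni_widen /g map_polyC hornerC /= mmapX mmap1U.
Qed.
End Muni.

(** Primes as plain predicates: preimages, zero ideals and towers indexed by [nat] need no bundled
    structure. They are bundled by [prime_idealr_of] where [krull_dim] requires it. *)
Record is_prime (A : comNzRingType) (P : A -> Prop) : Prop := IsPrime {
  is_prime0 : P 0;
  is_prime1 : ~ P 1;
  is_primeD : forall x y, P x -> P y -> P (x + y);
  is_primeMl : forall a x, P x -> P (a * x);
  is_primeM : forall x y, P (x * y) -> P x \/ P y
}.

Section PrimeTheory.
Variables (A : comNzRingType) (P : A -> Prop).
Hypothesis PP : is_prime P.

Lemma is_primeMr a x : P x -> P (x * a).
Proof. by move=> Px; rewrite mulrC; apply: is_primeMl. Qed.

Lemma is_primeN x : P x -> P (- x).
Proof. by move=> Px; rewrite -mulN1r; apply: is_primeMl. Qed.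

Lemma is_primeB x y : P x -> P y -> P (x - y).
Proof. by move=> Px Py; apply: is_primeD => //; apply: is_primeN. Qed.

Lemma is_prime_addIl x y : P x -> P (x + y) -> P y.
Proof. by move=> Px Pxy; 
 rewrite -[y](addKr x); apply: is_primeD => //; exact: is_primeN. Qed.

Lemma is_prime_sum (I : Type) (r : seq I) (Q : pred I) (F : I -> A) :
  (forall i, Q i -> P (F i)) -> P (\sum_(i <- r | Q i) F i).
Proof.
by move=> PF; elim/big_ind: _ => //; [exact: is_prime0 | exact: is_primeD].
Qed.

Lemma is_primeNX x m : ~ P x -> ~ P (x ^+ m).
Proof.
move=> Px; elim: m => [|m IH]; first by rewrite expr0; exact: is_prime1.
by rewrite exprS => /(is_primeM PP)[].
Qed.

Lemma is_prime_prod (I : eqType) (r : seq I) (F : I -> A) :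
  (forall i, i \in r -> ~ P (F i)) -> ~ P (\prod_(i <- r) F i).
Proof.
elim: r => [|i r IH] nF; first by rewrite big_nil; exact: is_prime1.
rewrite big_cons => /(is_primeM PP)[]; first by apply: nF; rewrite mem_head.
by apply: IH => j rj; apply: nF; rewrite inE rj orbT.
Qed.

End PrimeTheory.

Lemma is_prime_preim (A B : comNzRingType) (f : {rmorphism A -> B}) P :
  is_prime P -> is_prime (fun x => P (f x)).
Proof.
case=> P0 P1 PD PM PP; split; rewrite ?rmorph0 ?rmorph1 // => x y.
- by rewrite rmorphD; apply: PD.
- by rewrite rmorphM; apply: PM.
- by rewrite rmorphM; apply: PP.
Qed.

Lemma is_prime_zero (A : idomainType) : is_prime (fun x : A => x = 0).
Proof.
split=> [//||x y -> ->|a x ->|x y /eqP].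
- by move/eqP; rewrite oner_eq0.
- by rewrite addr0.
- by rewrite mulr0.
- by rewrite mulf_eq0 => /orP[]/eqP; [left|right].
Qed.

(** If p_i and q_j are the first coefficients outside P, coefficient i + j of the product is p_i q_j
    modulo P. *)
Lemma is_prime_poly (A : comNzRingType) (P : A -> Prop) :
  is_prime P -> is_prime (fun p : {poly A} => forall i, P p`_i).
Proof.
move=> PP; split.
- by move=> i; rewrite coef0; apply: is_prime0.
- by move=> /(_ 0%N); rewrite coef1; apply: is_prime1.
- by move=> p q Pp Pq i; rewrite coefD; apply: is_primeD.
- by move=> a p Pp i; rewrite coefM; apply: is_prime_sum => // j _;
  apply: is_primeMl.
move=> p q Ppq; apply: contrapT =>
  /not_orP[/existsNP/cid[i0 ni0] /existsNP/cid[j0 nj0]].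
have ei : exists i, `[< ~ P p`_i >] by exists i0; apply/asboolP.
have ej : exists j, `[< ~ P q`_j >] by exists j0; apply/asboolP.
case: (ex_minnP ei) => i /asboolP ni mi; case: (ex_minnP ej) => j /asboolP nj mj.
have := Ppq (i + j)%N; rewrite coefM.
have ij : (i < (i + j).+1)%N by rewrite ltnS leq_addr.
rewrite (bigD1 (Ordinal ij)) //= addKn addrC => H.
have {H} /(is_primeM PP)[]// : P (p`_i * q`_j).
apply: (is_prime_addIl PP _ H); apply: is_prime_sum => // l li.
have {}li : val l != i by apply: contra li => /eqP li; apply/eqP/val_inj.
case: (ltnP l i) => [lti|].
  apply: (is_primeMr PP); apply: contrapT => nl.
  by have := mi l (asboolT nl); rewrite leqNgt lti.
rewrite leq_eqVlt eq_sym (negPf li) /= => ltil.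
apply: (is_primeMl PP); apply: contrapT => nl.
have := mj _ (asboolT nl); rewrite leqNgt => /negP; apply.
by rewrite ltn_subLR ?ltn_add2r // -ltnS.
Qed.

(** * Algebraic independence modulo a prime *)

Section AlgIndep.
Variables (k : fieldType) (B : comNzRingType) (iota : {rmorphism k -> B}).

Definition alg_indep r (z : 'I_r -> B) (P : B -> Prop) : Prop :=
  forall F : {mpoly k[r]}, P (mmap iota z F) -> F = 0.

Lemma alg_indep0 (z : 'I_0 -> B) P : is_prime P -> alg_indep z P.
Proof.
move=> PP F; rewrite [F]mpoly0_const; move: (F@_0) => m.
rewrite mmapC; have [->//|m0 Pm] := eqVneq m 0.
case: (is_prime1 PP); rewrite -(rmorph1 iota) -(mulVf m0) rmorphM.
exact: is_primeMl.
Qed.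

Definition ord_snoc r (z : 'I_r -> B) (x : B) (i : 'I_r.+1) : B :=
  oapp z x (unlift ord_max i).

Lemma ord_snoc_max r (z : 'I_r -> B) x : ord_snoc z x ord_max = x.
Proof. by rewrite /ord_snoc unlift_none. Qed.

Lemma mmap_snoc r (z : 'I_r -> B) x F :
  mmap iota (ord_snoc z x) F = (map_poly (mmap iota z) (muni F)).[x].
Proof.
rewrite mmap_muni ord_snoc_max; congr (_.[x]); apply: eq_map_poly => G.
rewrite /mmap; apply: eq_bigr => m _; congr (_ * _); apply: mmap1_eq => i.
rewrite /ord_snoc (_ : widen_ord _ i = lift ord_max i) ?liftK //.
by apply: val_inj; rewrite /= /bump leqNgt ltn_ord.
Qed.

(* If w lies in P' but not in the smaller prime P, then an algebraic relation
   modulo P on (y, w), divided by a power of w, has constant term in P'. *)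
Lemma alg_indep_step r (y : 'I_r -> B) (P P' : B -> Prop) w :
    is_prime P -> is_prime P' -> (forall x, P x -> P' x) -> P' w -> ~ P w ->
  alg_indep y P' -> alg_indep (ord_snoc y w) P.
Proof.
move=> PP PP' sub P'w nPw ind F; rewrite mmap_snoc => PF.
apply: (@muni_inj _ r); rewrite rmorph0.
move: (muni F) PF => {F}; elim/poly_ind => [//|p c IH].
rewrite rmorphD rmorphM /= map_polyX map_polyC hornerD hornerMX hornerC /= => H.
have c0 : c = 0.
  by apply: ind; apply: (is_prime_addIl PP' _ (sub _ H)); apply: is_primeMl.
move: H; rewrite c0 rmorph0 addr0 => /(is_primeM PP)[|//] /IH ->.
by rewrite mul0r addr0.
Qed.

(** Each of the e strict inclusions supplies one more independent element, by descending from the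
    top prime to the bottom one. *)
Lemma chain_alg_indep e (c : nat -> B -> Prop) r (z : 'I_r -> B) :
    (forall i, (i <= e)%N -> is_prime (c i)) ->
    (forall i, (i < e)%N -> (forall x, c i x -> c i.+1 x) /\
                            (exists2 x, c i.+1 x & ~ c i x)) ->
    alg_indep z (c e) ->
  exists y : 'I_(e + r) -> B, alg_indep y (c 0%N).
Proof.
elim: e c => [|e IH] c cP cS cz; first by exists z.
have [|i ie|//|y cy] := IH (fun i => c i.+1); first by move=> i ie; apply: cP.
  exact: cS.
have [sub [w c1w c0w]] := cS 0%N isT.
by exists (ord_snoc y w); apply: alg_indep_step sub c1w c0w cy; apply: cP.
Qed.

End AlgIndep.

(** * Transcendence degree by counting dimensions *)

Section TranscendenceDegree.
Variables (k : fieldType) (n : nat) (L : idomainType).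
Variables (u : {rmorphism {mpoly k[n]} -> L}) (u_inj : injective u).

Definition mbox (r b : nat) (f : {ffun 'I_r -> 'I_b}) : 'X_{1..r} :=
  [multinom f i : nat | i < r].

Lemma mpoly_box b (p : {mpoly k[n]}) : (msize p <= b)%N ->
  (forall f : {ffun 'I_n -> 'I_b}, p@_(mbox f) = 0) -> p = 0.
Proof.
move=> pb H; apply/mpolyP => m; rewrite mcoeff0.
have [mb|mb] := ltnP (mdeg m) b; last first.
  by apply/memN_msupp_eq0/msize_mdeg_ge; apply: leq_trans mb.
have mib i : (m i < b)%N.
  by apply: leq_ltn_trans mb; rewrite mdegE (bigD1 i) //= leq_addr.
rewrite -(H [ffun i => Ordinal (mib i)]); congr (_@__).
by apply/mnmP => i; rewrite mnmE ffunE.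
Qed.

Lemma msizeM_leq (p q : {mpoly k[n]}) a b :
  (msize p <= a.+1)%N -> (msize q <= b.+1)%N -> (msize (p * q) <= (a + b).+1)%N.
Proof.
have [->|p0] := eqVneq p 0; first by rewrite mul0r msize0.
have [->|q0] := eqVneq q 0; first by rewrite mulr0 msize0.
move=> pa qb; rewrite msizeM //.
by have := leq_add pa qb; rewrite addSn addnS; case: (_ + _)%N.
Qed.

Lemma msizeX_leq (p : {mpoly k[n]}) a e :
  (msize p <= a.+1)%N -> (msize (p ^+ e) <= (e * a).+1)%N.
Proof.
move=> pa; elim: e => [|e IH]; first by rewrite expr0 msize1.
by rewrite exprS mulSn; apply: msizeM_leq.
Qed.

Lemma msize_prod_leq m (p : 'I_m -> {mpoly k[n]}) (a : nat) :
  (forall i, msize (p i) <= a.+1)%N -> (msize (\prod_i p i) <= (m * a).+1)%N.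
Proof.
elim: m p => [|m IH] p pa; first by rewrite big_ord0 msize1.
by rewrite big_ord_recl mulSn; apply: msizeM_leq (pa _) (IH _ _).
Qed.

(* The T^m products of powers < T of the y_i, multiplied by a common
   denominator, lie in a space of polynomials of dimension O(T^n). *)
Lemma alg_indep_leq m (y : 'I_m -> L) (s : {mpoly k[n]}) (a : 'I_m -> {mpoly
  k[n]}) :
    s != 0 -> (forall i, u s * y i = u (a i)) ->
    alg_indep (u \o @mpolyC n k) y (fun x => x = 0) ->
  (m <= n)%N.
Proof.
move=> s0 ya ind; rewrite leqNgt; apply/negP => nm.
have [D [sD aD]] : exists D, (msize s <= D.+1)%N /\ forall i,
  (msize (a i) <= D.+1)%N.
  exists (maxn (msize s) (\max_i msize (a i))); split=> [|i]; apply: leqW.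
    exact: leq_maxl.
  apply: leq_trans (leq_maxr _ _); exact: (leq_bigmax i).
(* These constants give b <= E T, hence b^n <= E^n T^n < T^(n+1) <= T^m: there are more products
   [v f], each being s^(mT) times a monomial in y, than monomials in the box containing their
   supports. *)
pose E := (m * D).+1; pose T := (E ^ n).+1; pose b := (m * (T * D)).+1.
pose v (f : {ffun 'I_m -> 'I_T}) := \prod_i (a i ^+ f i * s ^+ (T - f i)).
have vb f : (msize (v f) <= b)%N.
  apply: msize_prod_leq => i.
  have -> : (T * D = f i * D + (T - f i) * D)%N.
    by rewrite -mulnDl subnKC // ltnW.
  by apply: msizeM_leq; apply: msizeX_leq.
pose M := \matrix_(i < #|{ffun 'I_m -> 'I_T}|, j < #|{ffun 'I_n -> 'I_b}|)
   (v (enum_val i))@_(mbox (enum_val j)).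
have card_lt : (#|{ffun 'I_n -> 'I_b}| < #|{ffun 'I_m -> 'I_T}|)%N.
  rewrite !card_ffun !card_ord.
  have bT : (b <= E * T)%N.
    by rewrite /b /E mulSn -add1n leq_add // (mulnC T) mulnA.
  apply: leq_trans (leq_pexp2l (ltn0Sn _) nm); rewrite expnS.
  have : (b ^ n <= (E * T) ^ n)%N.
    by elim: (n) => // e IH; rewrite !expnS; apply: leq_mul.
  by move/leq_ltn_trans; apply; rewrite expnMn ltn_pmul2r // expn_gt0.
have [w wM w0] : exists2 w : 'rV_#|{ffun 'I_m -> 'I_T}|, w *m M = 0 & w != 0.
  have : kermx M != 0.
    rewrite -mxrank_eq0 mxrank_ker -lt0n subn_gt0.
    exact: leq_ltn_trans (rank_leq_col _) card_lt.
  case/rowV0Pn => w /sub_kermxP wM w0; by exists w.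
have v0 : \sum_i w 0 i *: v (enum_val i) = 0.
  apply: (@mpoly_box b).
    rewrite -[b]/(b.-1.+1); elim/big_ind: _ => [|p q pb qb|i _].
    - by rewrite msize0.
    - by apply: leq_trans (msizeD_le _ _) _; rewrite geq_max pb.
    - by apply: leq_trans (msizeZ_le _ _) (vb _).
  move=> f; have /matrixP/(_ 0 (enum_rank f)) := wM.
  rewrite !mxE => E0; rewrite -[RHS]E0 linear_sum /=.
  by apply: eq_bigr => i _; rewrite mxE mcoeffZ enum_rankK.
have F0 : \sum_i w 0 i *: 'X_[mbox (enum_val i)] = 0 :> {mpoly k[m]}.
  apply: ind; rewrite rmorph_sum /=.
  have uT : u s ^+ (m * T) != 0 by rewrite expf_neq0 // raddf_eq0.
  apply: (mulfI uT); rewrite mulr0 mulr_sumr -[RHS](rmorph0 u) -[in RHS]v0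
    rmorph_sum.
  apply: eq_bigr => i _; rewrite mmapZ mmapX /= -mul_mpolyC rmorphM mulrCA;
    congr (_ * _).
  have -> : u s ^+ (m * T) = \prod_(j < m) u s ^+ T.
    by rewrite prodr_const card_ord -exprM mulnC.
  rewrite /v /mmap1 rmorph_prod -big_split.
  apply: eq_bigr => j _; rewrite mnmE rmorphM !rmorphXn -ya exprMn /= mulrAC -exprD.
  by rewrite subnKC // ltnW.
case/negP: w0; apply/eqP/rowP => i; rewrite mxE.
have := congr1 (mcoeff (mbox (enum_val i))) F0; rewrite mcoeff0 linear_sum /=.
rewrite (bigD1 i) //= mcoeffZ mcoeffX eqxx mulr1 big1 ?addr0 // => j ji.
rewrite mcoeffZ mcoeffX; case: eqP => [|_]; last by rewrite mulr0.
move=> E0; case/eqP: ji; apply: enum_val_inj; apply/ffunP => l; apply: val_inj.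
by have /mnmP/(_ l) := E0; rewrite !mnmE.
Qed.
End TranscendenceDegree.

(** * Regularity of localized polynomial rings *)

Definition prime_tower (A : comNzRingType) (d : nat) (c : nat -> A -> Prop) :
  Prop :=
  (forall i, (i <= d)%N -> is_prime (c i)) /\
  forall i, (i < d)%N -> (forall x, c i x -> c i.+1 x) /\
                         (exists2 x, c i.+1 x & ~ c i x).

(* For A = k[x_1, ..., x_n] this says that A_P is regular: the d-step chain below
   P bounds the dimension from below, and the n - d elements of A that are
   algebraically independent modulo P bound it from above. *)
Definition regular_prime (k : fieldType) (A : comNzRingType)
    (iota : {rmorphism k -> A}) (n : nat) (P : A -> Prop) : Prop :=
  exists d r (f : seq A) (z : 'I_r -> A) (c : nat -> A -> Prop),
  [/\ (d + r)%N = n, size f = d & alg_indep iota z P] /\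
  [/\ forall x, x \in f -> P x,
      forall x, P x -> exists2 s, ~ P s & s * x \in gen_ideal (mem f),
      prime_tower d c & forall x, c d x -> P x].

Lemma regular_prime_field (k : fieldType) (A : idomainType)
  (iota : {rmorphism k -> A}) P :
  (forall a, exists c, a = iota c) -> is_prime P -> regular_prime iota 0 P.
Proof.
move=> surj PP; exists 0%N, 0%N, [::], (fun=> 0), (fun _ x => x = 0).
split; split=> //.
- exact: alg_indep0.
- move=> x; have [c ->] := surj x; have [->|c0 Pc] := eqVneq c 0.
    exists 1; first exact: is_prime1.
    by rewrite mul1r rmorph0 gen_ideal0.
  case: (is_prime1 PP); rewrite -(rmorph1 iota) -(mulVf c0) rmorphM.
  exact: is_primeMl.
- by split=> // i _; apply: is_prime_zero.
by move=> x ->; apply: is_prime0.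
Qed.

Lemma regular_prime_iso (k : fieldType) (A B : comNzRingType)
    (f : {rmorphism A -> B}) (g : {rmorphism B -> A})
    (iotaA : {rmorphism k -> A}) (iotaB : {rmorphism k -> B}) n P :
    cancel f g -> cancel g f -> (forall c, f (iotaA c) = iotaB c) -> is_prime P ->
  regular_prime iotaA n (fun x => P (f x)) -> regular_prime iotaB n P.
Proof.
move=> fK gK fi PP [d [r [s [z [c [[dr sd zi] [sP Ps [cP cS] cd]]]]]]].
exists d, r, (map f s), (f \o z), (fun i x => c i (g x)); split; split=> //.
- by rewrite size_map.
- move=> F PF; apply: zi; move: PF; congr P.
  apply: (mpoly_rmorph_eq (f := mmap iotaB (f \o z)) (g := f \o mmap iotaA z)) =>
    [e|i] /=.
    by rewrite !mmapC fi.
  by rewrite !mmapX !mmap1U.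
- by move=> _ /mapP[x /sP ? ->].
- move=> x Px; have [|t nPt H] := Ps (g x); first by rewrite gK.
  by exists (f t) => //; rewrite -[x]gK -rmorphM gen_ideal_rmorph.
- split=> [i id|i id]; first by apply: is_prime_preim; apply: cP.
  have [sub [x cx ncx]] := cS _ id; split=> [y|]; first exact: sub.
  by exists (f x); rewrite fK.
by move=> x /cd; rewrite gK.
Qed.

(** There are finitely many coefficients, so the product of their denominators works for all. *)
Lemma gen_ideal_coefs (A : comNzRingType) (P : A -> Prop) (f : seq A) (p : {poly
  A}) : is_prime P ->
    (forall i, exists2 s, ~ P s & s * p`_i \in gen_ideal (mem f)) ->
  exists2 s, ~ P s & s%:P * p \in gen_ideal (mem (map polyC f)).
Proof.
move=> PP H; have /choice[S HS] : forall i, exists s,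
  ~ P s /\ s * p`_i \in gen_ideal (mem f).
  by move=> i; have [s] := H i; exists s.
exists (\prod_(i < size p) S i).
  by apply: is_prime_prod => // i _; case: (HS i).
rewrite -[X in _ * X]coefK poly_def mulr_sumr; apply: gen_ideal_sum => i _.
rewrite -mul_polyC mulrA -rmorphM; rewrite mulrC; apply: gen_idealMl.
apply: (gen_ideal_rmorph polyC); rewrite (bigD1 i) //= mulrAC mulrC.
by apply: gen_idealMl; case: (HS i).
Qed.

Section RegularPoly.
Variables (k : fieldType) (A : idomainType) (iota : {rmorphism k -> A}) (n : nat).
Hypothesis regA : forall P, is_prime P -> regular_prime iota n P.

(** With P the contraction of Q, either Q = P[X], and X is a further independent element; or Q is
    generated, up to denominators, by P and one polynomial, and is itself a further step on top of
    the chain of extended primes. *)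
Lemma regular_prime_poly (Q : {poly A} -> Prop) : is_prime Q ->
  regular_prime (polyC \o iota) n.+1 Q.
Proof.
move=> QQ; pose P a := Q a%:P.
have PP : is_prime P by apply: (is_prime_preim polyC).
have [d [r [f [z [c [[dr sd zi] [fP Pf [cP cS] cd]]]]]]] := regA PP.
have PQ (p : {poly A}) : (forall i, P p`_i) -> Q p.
  move=> Pp; rewrite -[p]coefK poly_def; apply: is_prime_sum => // i _.
  rewrite -mul_polyC; apply: (is_primeMr QQ); exact: Pp.
have mmapP r' (z' : 'I_r' -> A) F :
    mmap (polyC \o iota) (polyC \o z') F = (mmap iota z' F)%:P.
  apply: (mpoly_rmorph_eq (f := mmap (polyC \o iota) (polyC \o z'))
     (g := polyC \o mmap iota z')) => [e|i] /=.
    by rewrite !mmapC.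
  by rewrite !mmapX !mmap1U.
have fQ x : x \in map polyC f -> Q x by move=> /mapP[y /fP ? ->].
have cT : prime_tower d (fun i (p : {poly A}) => forall j, c i p`_j).
  split=> [i id|i id]; first by apply: is_prime_poly; apply: cP.
  have [sub [x cx ncx]] := cS _ id; split=> [p H j|]; first exact: sub.
  exists x%:P; last by move=> /(_ 0%N); rewrite coefC.
  by move=> j; rewrite coefC; case: eqP => // _; apply: is_prime0; apply: cP.
(* Here Q = P[X]: a relation in X modulo Q has all its coefficients in P. *)
have [QP|] := pselect (forall p : {poly A}, Q p -> forall i, P p`_i).
  exists d, r.+1, (map polyC f), (ord_snoc (polyC \o z) 'X),
    (fun i (p : {poly A}) => forall j, c i p`_j).
  split; split=> //.
  - by rewrite addnS dr.
  - by rewrite size_map.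
  - move=> F; rewrite mmap_snoc => QF; apply: (@muni_inj _ r); rewrite rmorph0.
    apply/polyP => i; rewrite coef0; apply: zi.
    move/QP/(_ i): QF; congr P.
    rewrite (_ : map_poly _ _ = map_poly polyC (map_poly (mmap iota z) (muni F))).
      by rewrite -[_.['X]]/(_ \Po 'X) comp_polyXr coef_map.
    by rewrite -map_poly_comp; apply: eq_map_poly => G; rewrite mmapP.
  - move=> p Qp; have [|s nPs Hs] := @gen_ideal_coefs A P f p PP.
      by move=> i; apply: Pf; apply: QP.
    by exists s%:P.
  by move=> p H; apply: PQ => i; apply: cd.
move=> /existsNP[p0 /not_implyP[Qp0 /existsNP[i0 ni0]]].
(* Least size of an element of Q outside P[X]; it is attained by [g], and all smaller elements of Q
   lie in P[X]. *)
pose bad m := `[< exists2 p : {poly A}, Q p /\ size p = m & exists i, ~ P p`_i >].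
have ebad : exists m, bad m.
  by exists (size p0); apply/asboolP; exists p0 => //; exists i0.
case: (ex_minnP ebad) => m /asboolP[g [Qg sg] [i ngi]] mmin {p0 Qp0 i0 ni0 ebad}.
have small (p : {poly A}) : Q p -> (size p < m)%N -> forall i, P p`_i.
  move=> Qp pm j; apply: contrapT => nj; have := mmin (size p).
  rewrite leqNgt pm => H; suff: false by [].
  by apply: H; apply/asboolP; exists p => //; exists j.
have g0 : g != 0.
  by apply: contra_notN ngi => /eqP->; rewrite coef0; apply: is_prime0.
have sg0 : (0 < size g)%N by rewrite size_poly_gt0.
(* Otherwise removing the leading term of [g] would leave a smaller element of Q outside P[X]. *)
have nlead : ~ P (lead_coef g).
  move=> Plead; apply: ngi; have Ql : Q (lead_coef g *: 'X^((size g).-1)).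
    by rewrite -mul_polyC; apply: (is_primeMr QQ).
  have : P (g - lead_coef g *: 'X^((size g).-1))`_i.
    apply: small; first exact: is_primeB.
    rewrite -sg -[X in (_ < X)%N](prednK sg0) ltnS; apply/leq_sizeP => j.
    rewrite coefB coefZ coefXn leq_eqVlt => /orP[/eqP<-|jl].
      by rewrite eqxx mulr1 subrr.
    rewrite gtn_eqF // mulr0 subr0 nth_default //.
    by rewrite (prednK sg0) in jl.
  move=> H; rewrite -[g](subrK (lead_coef g *: 'X^((size g).-1))) coefD.
  apply: is_primeD => //; rewrite coefZ; exact: is_primeMr.
exists d.+1, r, (g :: map polyC f), (polyC \o z),
  (fun i (p : {poly A}) => if (i <= d)%N then forall j, c i p`_j else Q p).
split; split=> //.
- by rewrite addSn dr.
- by rewrite /= size_map sd.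
- by move=> F; rewrite mmapP => /zi.
- by move=> x; rewrite inE => /orP[/eqP->|/fQ].
(* Pseudo-division by [g]: the denominator [l] is a power of its leading coefficient, hence outside
   P, and the remainder is small enough to lie in P[X]. *)
- move=> p Qp; have := Pdiv.Idomain.divp_eq p g; set l := _ ^+ _;
  set q := p %/ g => E.
  have Qr : Q (p %% g).
    have -> : p %% g = l *: p - q * g by rewrite E addrC addKr.
    by apply: is_primeB => //; [rewrite -mul_polyC|]; apply: is_primeMl.
  have [|s nPs Hs] := @gen_ideal_coefs A P f (p %% g) PP.
    by move=> j; apply: Pf; apply: small; rewrite // -sg Pdiv.Idomain.ltn_modpN0.
  exists (s * l)%:P.
    by move=> /(is_primeM PP)[//|]; apply: (is_primeNX PP).
  rewrite rmorphM -mulrA (mul_polyC l) E mulrDr; apply: gen_idealD.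
    by rewrite mulrA; apply/gen_idealMl/mem_gen_seq; rewrite mem_head.
  by apply: gen_ideal_subseq Hs => x fx; rewrite inE fx orbT.
- have [cTP cTS] := cT; split=> j jd.
    by case: (leqP j d) => [/cTP|].
  have jd0 : (j <= d)%N by [].
  rewrite jd0; case: (ltnP j d) => [/cTS//|dj].
  have {dj jd jd0} -> : j = d by apply/eqP; rewrite eqn_leq jd0.
  split=> [p H|]; first by apply: PQ => i'; apply: cd.
  by exists g => // /(_ i) H; apply: ngi; apply: cd.
by rewrite ltnn.
Qed.
End RegularPoly.

Lemma regular_prime_mpoly (k : fieldType) n (P : {mpoly k[n]} -> Prop) :
  is_prime P -> regular_prime (@mpolyC n k) n P.
Proof.
elim: n P => [|n IH] P PP.
  by apply: regular_prime_field => // p; exists p@_0; apply: mpoly0_const.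
apply: (@regular_prime_iso _ _ _ (@muni_inv k n) (@muni n k) (polyC \o @mpolyC n
  k)) => //.
- exact: muni_invK.
- exact: muniK.
- by move=> c; rewrite /= /muni_inv map_polyC hornerC /= mwidenC.
by apply: regular_prime_poly => //; apply: is_prime_preim.
Qed.

Section PrimeIdealr.
Variables (A : comNzRingType) (P : A -> Prop).

Definition prime_pred of is_prime P : {pred A} := fun x => `[< P x >].

Variable PP : is_prime P.

Lemma prime_predP x : reflect (P x) (x \in prime_pred PP).
Proof. exact: asboolP. Qed.

Lemma prime_pred_idealr : idealr_closed (prime_pred PP).
Proof.
split=> [||a u v /prime_predP Pu /prime_predP Pv].
- by apply/prime_predP; exact: is_prime0.
- by apply/prime_predP; exact: is_prime1.
by apply/prime_predP; apply: is_primeD => //; apply: is_primeMl.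
Qed.

Lemma prime_pred_prime : prime_idealr_closed (prime_pred PP).
Proof.
by move=> u v /prime_predP /(is_primeM PP) H; apply/orP; case: H; [left|right];
  apply/prime_predP.
Qed.

HB.instance Definition _ := isIdealr.Build A (prime_pred PP) prime_pred_idealr.
HB.instance Definition _ := isPrimeIdealrClosed.Build A (prime_pred PP)
  prime_pred_prime.

Definition prime_idealr_of : prime_idealr A := prime_pred PP.

End PrimeIdealr.

Lemma is_prime_idealr (A : comNzRingType) (P : prime_idealr A) :
  is_prime (fun x => x \in (P : {pred A})).
Proof.
split=> [||x y Px Py|a x|x y].
- exact: idealr0.
- by rewrite idealr1.
- exact: rpredD.
- exact: idealMr.
- by rewrite prime_idealrM => /orP.
Qed.

Lemma prime_chain_tower (A : comNzRingType) e (c : 'I_e.+1 -> prime_idealr A) :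
  prime_chain c -> prime_tower e (fun i x => x \in (c (inord i) : {pred A})).
Proof.
move=> cc; split=> i ie; first exact: is_prime_idealr.
have [|sub nsub] := cc (inord i) (inord i.+1).
  by rewrite !inordK // ltnW.
split; first exact: sub.
move/existsNP: nsub => [x /not_implyP[]]; by exists x.
Qed.

Lemma prime_tower_sub (A : comNzRingType) d (c : nat -> A -> Prop) i j x :
  prime_tower d c -> (i <= j)%N -> (j <= d)%N -> c i x -> c j x.
Proof.
move=> [_ cS] ij jd cx; elim: j ij jd => [|j IH].
  by rewrite leqn0 => /eqP <-.
rewrite leq_eqVlt => /orP[/eqP<-//|ij] jd.
by apply: (cS _ jd).1; apply: IH => //; apply: ltnW.
Qed.

(** * Local rings and localizations of polynomial rings *)

Section Local.
Variables (B : comNzRingType) (m : B -> Prop) (mP : is_prime m).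
Hypothesis m_unit : forall b, ~ m b -> exists b', b * b' = 1.

Lemma local_sub (J : {pred B}) : idealr_closed J -> forall x, x \in J -> m x.
Proof.
move=> [J0 J1 JL] x Jx; apply: contrapT => /m_unit[y xy].
by case/negP: J1; rewrite -xy mulrC -[_ * _]addr0 JL.
Qed.

Lemma local_maximal : maximal_ideal (prime_pred mP).
Proof.
split=> [|J JI _ x Jx]; first exact: prime_pred_idealr.
by apply/prime_predP; apply: local_sub Jx.
Qed.

Lemma local_unique m' : maximal_ideal m' -> m' =i prime_pred mP.
Proof.
move=> [m'I m'M] x; apply/idP/idP => [m'x|].
  by apply/prime_predP; apply: local_sub m'x.
apply: (m'M _ (prime_pred_idealr mP)) => y m'y.
by apply/prime_predP; apply: local_sub m'y.
Qed.

Section Localization.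
Variables (k : fieldType) (n : nat) (h : {rmorphism {mpoly k[n]} -> B}).
Hypothesis h_inj : injective h.
Hypothesis hB : forall b, exists a s s', h s * s' = 1 /\ b * h s = h a.
Hypothesis dimB : forall r (y : 'I_r -> B),
  alg_indep (h \o @mpolyC n k) y (fun x => x = 0) -> (r <= n)%N.

(** The extension of [c] to B: fractions a / s with a in [c], written without division. *)
Definition ext_prime (c : {mpoly k[n]} -> Prop) (b : B) : Prop :=
  exists a s, [/\ ~ m (h s), b * h s = h a & c a].

Lemma m_inv x y : x * y = 1 -> ~ m x.
Proof.
by move=> xy mx; apply: (is_prime1 mP); rewrite -xy; apply: is_primeMr.
Qed.

Section ExtPrime.
Variables (c : {mpoly k[n]} -> Prop) (cP : is_prime c) (cm : forall x,
  c x -> m (h x)).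

(** Since [c] lies in the contraction of m, no denominator belongs to [c], and contracting the
    extension gives [c] back. *)
Lemma ext_primeE a : ext_prime c (h a) <-> c a.
Proof.
split=> [[a' [s [ms E ca']]]|ca].
  move: E; rewrite -rmorphM => /h_inj E; move: ca'; rewrite -E.
  by case/(is_primeM cP) => // /cm.
exists a, 1; rewrite rmorph1 mulr1; split=> //; exact: is_prime1.
Qed.

Lemma ext_prime_prime : is_prime (ext_prime c).
Proof.
split.
- by rewrite -(rmorph0 h) ext_primeE; apply: is_prime0.
- by rewrite -(rmorph1 h) ext_primeE; apply: is_prime1.
- move=> x y [a [s [ms E ca]]] [a' [s' [ms' E' ca']]].
  exists (s' * a + s * a'), (s * s'); split.
  + by rewrite rmorphM => /(is_primeM mP)[].
  + by rewrite rmorphD !rmorphM -E -E'; ring.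
  + by apply: is_primeD => //; apply: is_primeMl.
- move=> x y [a [s [ms E ca]]]; have [b [t [t' [tt E']]]] := hB x.
  exists (b * a), (t * s); split; last exact: is_primeMl.
    by rewrite rmorphM => /(is_primeM mP)[|//]; apply: m_inv tt.
  by rewrite !rmorphM -E -E' mulrACA.
move=> x y [a [s [ms E ca]]].
have [b [t [t' [tt Eb]]]] := hB x; have [b1 [t1 [t1' [tt1 Eb1]]]] := hB y.
have : c (b * b1 * s).
  have -> : b * b1 * s = t * t1 * a.
    by apply: h_inj; rewrite !rmorphM -Eb -Eb1 -E; ring.
  exact: is_primeMl.
case/(is_primeM cP) => [|/cm//]; case/(is_primeM cP) => ?; [left|right].
  by exists b, t; split=> //; apply: m_inv tt.
by exists b1, t1; split=> //; apply: m_inv tt1.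
Qed.
End ExtPrime.

Lemma tower_leq e (c : nat -> B -> Prop) r (z : 'I_r -> B) :
  prime_tower e c -> alg_indep (h \o @mpolyC n k) z (c e) -> (e + r <= n)%N.
Proof.
move=> [cP cS] /(chain_alg_indep cP cS)[y yi]; apply: (dimB (y := y)) => F E.
by apply: yi; rewrite E; apply: is_prime0; apply: cP.
Qed.

(** The data of [regular_prime] at the contraction of m pass to B: the chain extends step by step,
    and the generators generate m because all denominators are units. *)
Lemma regular_local_localization : regular_local B.
Proof.
split.
  apply: noetherian_loc hB _; elim: (n) => [|n' IH].
    apply: (@noetherian_loc k _ (@mpolyC 0 k)); last exact: noetherian_field.
    move=> p; exists p@_0, 1, 1; rewrite !rmorph1 !mulr1; split=> //.
    exact: mpoly0_const.
  apply: (@noetherian_loc {poly {mpoly k[n']}} _ (@muni_inv k n')); last first.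
    exact: noetherian_poly.
  move=> p; exists (muni p), 1, 1; rewrite !rmorph1 !mulr1; split=> //.
  by apply/esym/muniK.
have PP : is_prime (fun a => m (h a)) by apply: is_prime_preim.
have [d [r [f [z [c [[dr sd zi] [fP Pf [cP cS] cd]]]]]]] := regular_prime_mpoly PP.
exists (prime_pred mP); split; [exact: local_maximal | exact: local_unique |].
have csub i : (i <= d)%N -> forall x, c i x -> m (h x).
  by move=> id x cx; apply: cd; apply: (prime_tower_sub (conj cP cS)) cx.
exists d; last first.
  exists (map h f); first by rewrite size_map.
  move=> b; apply/prime_predP/idP => [mb|].
    have [a [s [s' [ss E]]]] := hB b.
    have /Pf[t /m_unit[t' tt] ta] : m (h a) by rewrite -E; apply: is_primeMr.
    have -> : b = (s' * t') * h (t * a).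
      rewrite rmorphM -E; transitivity (b * (h s * s') * (h t * t')); last by ring.
      by rewrite ss tt !mulr1.
    exact/gen_idealMl/gen_ideal_rmorph.
  move/gen_ideal_sub => H; apply/(prime_predP mP); apply: H.
    split=> [|a u v /prime_predP mu /prime_predP mv]; apply/prime_predP.
      exact: is_prime0.
    by apply: is_primeD => //; apply: is_primeMl.
  by move=> _ /mapP[a /fP ? ->]; apply/prime_predP.
split=> [|e [C /prime_chain_tower CT]].
  have ecP (i : 'I_d.+1) : is_prime (ext_prime (c i)).
    by apply: ext_prime_prime; [apply: cP | apply: csub]; rewrite -ltnS.
  exists (fun i => prime_idealr_of (ecP i)) => i j ij; split.
    move=> x /prime_predP[a [s [ms E ca]]]; apply/prime_predP; exists a, s;
      split=> //.
    by apply: (prime_tower_sub (conj cP cS)) ca; [exact: ltnW | rewrite -ltnS].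
  have id : (i < d)%N by apply: leq_trans ij _; rewrite -ltnS.
  have [_ [x cx ncx]] := cS _ id.
  move=> /(_ (h x)) H; apply: ncx;
    apply/(ext_primeE (cP _ (ltnW id)) (csub _ (ltnW id))).
  apply/(prime_predP (ecP i)); apply: H; apply/(prime_predP (ecP j)).
  apply/ext_primeE; [apply: cP; by rewrite -ltnS|apply: csub; by rewrite -ltnS|].
  by apply: (prime_tower_sub (conj cP cS)) cx; rewrite // -ltnS.
(* Every proper ideal lies in m, so [z] stays independent modulo the top of any chain; a chain of
   length e then satisfies e + r <= n = d + r. *)
have zi' : alg_indep (h \o @mpolyC n k) (h \o z)
    (fun x => x \in (C (inord e) : {pred B})).
  move=> F CF; apply: zi; apply: (local_sub (J := C (inord e))).
    split; [exact: idealr0 | by rewrite idealr1 |].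
    by move=> a u v Cu Cv; rewrite rpredD ?idealMr.
  rewrite [h _](_ : _ = mmap (h \o @mpolyC n k) (h \o z) F) //; apply/esym.
  apply: (mpoly_rmorph_eq (f := mmap (h \o @mpolyC n k) (h \o z))
    (g := h \o mmap (@mpolyC n k) z)) => [c0|i] /=; first by rewrite !mmapC.
  by rewrite !mmapX !mmap1U.
by have := tower_leq CT zi'; rewrite -dr leq_add2r.
Qed.
End Localization.
End Local.

(** * Stalks of a blowup *)

Section ReesMonomials.
Variables (R : idomainType) (I : {pred R}).

Lemma rees_monomial_subproof d (a : R) :
  a \in ideal_exp I d -> a *: 'X^d \in rees_pred I.
Proof.
move=> Ia; apply/rees_predP => i; rewrite coefZ coefXn.
by case: eqP => [->|_]; rewrite ?mulr1 ?mulr0 ?gen_ideal0.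
Qed.

Definition rees_monomial d (a : R) (Ia : a \in ideal_exp I d) : rees I :=
  Rees (rees_monomial_subproof Ia).

Lemma rees_monomial_homog d (a : R) (Ia : a \in ideal_exp I d) :
  rees_homog d (rees_monomial Ia).
Proof. by apply/rees_homogE; rewrite /= coefZ coefXn eqxx mulr1. Qed.

Lemma rees_sum_comp (f : rees I) : f = \sum_(d < size (f : {poly R})) rees_comp d f.
Proof.
apply: val_inj; rewrite [RHS]raddf_sum /= -[LHS]coefK poly_def.
by apply: eq_bigr.
Qed.

Lemma ideal_exp1 a : a \in I -> a \in ideal_exp I 1.
Proof.
move=> Ia; apply/mem_gen_ideal/asboolP; exists (fun=> a) => //.
by rewrite big_ord1.
Qed.

End ReesMonomials.

Section Point.
Variables (R : idomainType) (I : {pred R}) (P : blowup I).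
Local Notation Pp := (P : {pred rees I}).

(** Membership of a t^d in the prime of the point. Both this and [out_pt] include a in I^d, so they
    are complementary only on I^d. *)
Definition in_pt d (a : R) := exists2 f : rees I,
  f \in Pp & (f : {poly R}) = a *: 'X^d.
Definition out_pt d (a : R) := exists2 f : rees I,
  f \notin Pp & (f : {poly R}) = a *: 'X^d.

Lemma ptP d (a : R) : a \in ideal_exp I d -> in_pt d a \/ out_pt d a.
Proof.
move=> Ia; case: (boolP (rees_monomial Ia \in Pp)); [left|right];
  by exists (rees_monomial Ia).
Qed.

Lemma in_ptN_out d a : in_pt d a -> ~ out_pt d a.
Proof.
move=> [f Pf Ef] [g Pg Eg]; case/negP: Pg; suff <- : f = g by [].
by apply: val_inj; rewrite /= Ef Eg.
Qed.

Lemma val_monomial_mem d a (f : rees I) :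
  (f : {poly R}) = a *: 'X^d -> a \in ideal_exp I d.
Proof. by move=> E; have := reesP f d; rewrite E coefZ coefXn eqxx mulr1. Qed.

Lemma in_pt_mem d a : in_pt d a -> a \in ideal_exp I d.
Proof. by case=> f _ /val_monomial_mem. Qed.

Lemma out_pt_mem d a : out_pt d a -> a \in ideal_exp I d.
Proof. by case=> f _ /val_monomial_mem. Qed.

Lemma monomialM d e (a b : R) : a *: 'X^d * (b *: 'X^e) = (a * b) *: 'X^(d + e).
Proof. by rewrite -scalerAl -scalerAr scalerA exprD. Qed.

Lemma out_ptM d e a b : out_pt d a -> out_pt e b -> out_pt (d + e) (a * b).
Proof.
move=> [f Pf Ef] [g Pg Eg]; exists (f * g);
  last by rewrite rees_valM Ef Eg monomialM.
by rewrite prime_idealrM negb_or Pf.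
Qed.

Lemma out_pt1 : out_pt 0 1.
Proof. by exists 1; rewrite ?idealr1 // rees_val1 expr0 scale1r. Qed.

Lemma out_ptX d a m : out_pt d a -> out_pt (m * d) (a ^+ m).
Proof.
move=> da; elim: m => [|m IH]; first exact: out_pt1.
by rewrite mulSn exprS; apply: out_ptM.
Qed.

Lemma out_pt_neq0 d a : out_pt d a -> a != 0.
Proof.
move=> [f Pf Ef]; apply: contra Pf => /eqP a0.
suff -> : f = 0 by exact: idealr0.
by apply: val_inj; rewrite /= Ef a0 scale0r.
Qed.

Lemma in_ptMl d e a b : a \in ideal_exp I d -> in_pt e b -> in_pt (d + e) (a * b).
Proof.
move=> Ia [f Pf Ef]; exists (rees_monomial Ia * f); first exact: idealMr.
by rewrite rees_valM Ef monomialM.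
Qed.

Lemma in_ptD d a b : in_pt d a -> in_pt d b -> in_pt d (a + b).
Proof.
move=> [f Pf Ef] [g Pg Eg]; exists (f + g); first exact: rpredD.
by rewrite scalerDl -Ef -Eg.
Qed.

Lemma in_pt0 d : in_pt d 0.
Proof. by exists 0; rewrite ?idealr0 // scale0r. Qed.

(** If x t were in the prime for every generator x, so would be every component of positive degree,
    hence the irrelevant ideal. *)
Lemma ex_generator_out (X : {pred R}) : I = gen_ideal X ->
  exists2 x, x \in X & out_pt 1 x.
Proof.
move=> EI; apply: contrapT => /forall2NP noX; case: (pt_relevant (b := P)).
have inX x : x \in X -> in_pt 1 x.
  move=> Xx; have [//|oX] : in_pt 1 x \/ out_pt 1 x.
    by apply/ptP/ideal_exp1; rewrite EI; apply: mem_gen_ideal.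
  by case: (noX x).
have in1 a : a \in I -> in_pt 1 a.
  rewrite {1}EI => /asboolP[s sX ->]; rewrite big_seq.
  elim/big_rec: _ => [|p x ps]; first exact: in_pt0.
  apply: in_ptD; rewrite -[1%N]add0n; apply: in_ptMl (inX _ (sX _ ps)).
  exact: ideal_exp0.
have ind d a : a \in ideal_exp I d.+1 -> in_pt d.+1 a.
  move=> /asboolP[s sX ->]; rewrite big_seq.
  elim/big_rec: _ => [|p x ps]; first exact: in_pt0.
  apply: in_ptD; have /asboolP[b Ib ->] := sX _ ps.
  apply: (@in_ptMl 0); first exact: ideal_exp0.
  rewrite big_ord_recr /=.
  have := @in_ptMl d 1 (\prod_(i < d) b (widen_ord (leqnSn d) i)) (b ord_max).
  rewrite addn1; apply; last exact: in1.
  by apply/mem_gen_ideal/asboolP; eexists; last reflexivity.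
move=> f /eqP f0; rewrite [f]rees_sum_comp; apply: rpred_sum => -[[|d] di] _ /=.
  by rewrite f0 idealr0.
have [g Pg Eg] := ind _ _ (reesP f d.+1); suff -> : rees_comp d.+1 f = g by [].
by apply: val_inj; rewrite /= Eg.
Qed.

Local Notation K := {fraction {poly R}}.

Definition frac_const (x : R) : K := FracField.tofrac x%:P.

Lemma frac_const_zmod : zmod_morphism frac_const.
Proof. by move=> x y; rewrite /frac_const !rmorphB. Qed.
Lemma frac_const_monoid : monoid_morphism frac_const.
Proof. by split=> [|x y]; rewrite /frac_const ?rmorph1 ?rmorphM. Qed.
HB.instance Definition _ := GRing.isZmodMorphism.Build _ _ frac_const
  frac_const_zmod.
HB.instance Definition _ := GRing.isMonoidMorphism.Build _ _ frac_const
  frac_const_monoid.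

Lemma frac_const_inj : injective frac_const.
Proof. by move=> x y /eqP; rewrite tofrac_eq => /eqP/polyC_inj. Qed.

Lemma frac_const_eq0 x : (frac_const x == 0) = (x == 0).
Proof. by rewrite tofrac_eq0 polyC_eq0. Qed.

Lemma tofrac_monomial_div d (a s : R) :
  FracField.tofrac (a *: 'X^d : {poly R}) / FracField.tofrac (s *: 'X^d : {poly
    R}) =
  frac_const a / frac_const s.
Proof.
have X0 : FracField.tofrac ('X^d : {poly R}) != 0 by rewrite tofrac_eq0
  -size_poly_gt0 size_polyXn.
by rewrite -!mul_polyC !rmorphM /= -mulf_div divff // mulr1.
Qed.

(** The powers of t cancel in a fraction of degree 0, so the stalk lies in Frac R. *)
Lemma stalk_ex (z : stalk P) : exists d a s,
  [/\ a \in ideal_exp I d, out_pt d s & stalk_val z * frac_const s = frac_const a].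
Proof.
case: z => z /= zP; have /asboolP[d [a [s [/rees_homogE ha /rees_homogE hs Ps
  ->]]]] := zP.
exists d, (a : {poly R})`_d, (s : {poly R})`_d; split; first exact: reesP.
  by exists s.
have os : out_pt d (s : {poly R})`_d by exists s.
by rewrite ha hs tofrac_monomial_div !coefZ !coefXn !eqxx !mulr1 divfK //
  frac_const_eq0 (out_pt_neq0 os).
Qed.

Lemma stalk_mk d a s : a \in ideal_exp I d -> out_pt d s ->
  exists z : stalk P, stalk_val z = frac_const a / frac_const s.
Proof.
move=> Ia [f Pf Ef]; suff zP : frac_const a / frac_const s \in stalk_pred P by
  exists (Stalk zP).
apply/asboolP; exists d, (rees_monomial Ia), f; split=> //.
- exact: rees_monomial_homog.
- by apply/rees_homogE; rewrite Ef coefZ coefXn eqxx mulr1.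
by rewrite Ef /= tofrac_monomial_div.
Qed.

Lemma stalk_const_subproof (x : R) : frac_const x \in stalk_pred P.
Proof.
have [z Ez] := stalk_mk (ideal_exp0 I x) out_pt1.
by rewrite -[frac_const x]divr1 -(rmorph1 frac_const) -Ez; case: (z).
Qed.

Definition stalk_const (x : R) : stalk P := Stalk (stalk_const_subproof x).

Lemma stalk_const_zmod : zmod_morphism stalk_const.
Proof. by move=> x y; apply: val_inj; rewrite /= rmorphB. Qed.
Lemma stalk_const_monoid : monoid_morphism stalk_const.
Proof. by split=> [|x y]; apply: val_inj; rewrite /= ?rmorph1 ?rmorphM. Qed.
HB.instance Definition _ := GRing.isZmodMorphism.Build _ _ stalk_const
  stalk_const_zmod.
HB.instance Definition _ := GRing.isMonoidMorphism.Build _ _ stalk_const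
  stalk_const_monoid.

Definition stalk_max (z : stalk P) : Prop := exists d a s,
  [/\ in_pt d a, out_pt d s & stalk_val z * frac_const s = frac_const a].

Lemma stalk_frac_eq (z : K) a s b t :
  z * frac_const s = frac_const a -> z * frac_const t = frac_const b ->
    a * t = b * s.
Proof.
by move=> E1 E2; apply: frac_const_inj; rewrite !rmorphM /= -E1 -E2 mulrAC.
Qed.

(** Cross-multiplying two representations of z would put one element of degree d + e both inside and
    outside the prime. So [stalk_max] can be tested on any representation. *)
Lemma stalk_max_out (z : stalk P) d a s : stalk_max z ->
  out_pt d a -> out_pt d s -> stalk_val z * frac_const s = frac_const a -> False.
Proof.
move=> [e [b [t [ib ot E]]]] oa os E';
  apply: (in_ptN_out (d := d + e) (a := b * s)).
  by rewrite mulrC; apply: in_ptMl => //; apply: out_pt_mem.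
by rewrite -(stalk_frac_eq E' E); apply: out_ptM.
Qed.

Lemma stalk_max_prime : is_prime stalk_max.
Proof.
split.
- exists 0%N, 0, 1; split; [exact: in_pt0 | exact: out_pt1 |].
  by rewrite rmorph0 mul0r.
- by move=> /stalk_max_out; apply;
  [exact: out_pt1 | exact: out_pt1 | rewrite mul1r].
- move=> x y [d [a [s [ia os E]]]] [e [b [t [ib ot E']]]].
  exists (d + e)%N, (t * a + s * b), (s * t); split.
  + apply: in_ptD; last by apply: in_ptMl => //; apply: out_pt_mem.
    by rewrite addnC; apply: in_ptMl => //; apply: out_pt_mem.
  + exact: out_ptM.
  + by rewrite rmorphD !rmorphM /= -E -E'; ring.
- move=> x y [d [a [s [ia os E]]]]; have [e [b [t [Ib ot E']]]] := stalk_ex x.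
  exists (e + d)%N, (b * a), (t * s); split; [exact: in_ptMl | exact: out_ptM |].
  by rewrite !rmorphM /= -E -E'; ring.
move=> x y xy; have [d [a [s [Ia os E]]]] := stalk_ex x.
have [e [b [t [Ib ot E']]]] := stalk_ex y.
have [ia|oa] := ptP Ia; first by left; exists d, a, s.
have [ib|ob] := ptP Ib; first by right; exists e, b, t.
case: (stalk_max_out xy (out_ptM oa ob) (out_ptM os ot)).
by rewrite !rmorphM /= -E -E'; ring.
Qed.

Lemma stalk_unit (z : stalk P) : ~ stalk_max z -> exists z', z * z' = 1.
Proof.
move=> nz; have [d [a [s [Ia os E]]]] := stalk_ex z.
have [ia|oa] := ptP Ia; first by case: nz; exists d, a, s.
have [z' Ez'] := stalk_mk (out_pt_mem os) oa; exists z'; apply: val_inj => /=.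
by rewrite Ez' mulrA E divff // frac_const_eq0 (out_pt_neq0 oa).
Qed.

End Point.

(** The product of the denominators of the y_i is the common denominator that [alg_indep_leq] asks
    for. *)
Lemma stalk_alg_indep_leq (k : fieldType) n (I : {pred {mpoly k[n]}}) (P : blowup
  I) r
    (y : 'I_r -> stalk P) :
  alg_indep (@stalk_const _ _ P \o @mpolyC n k) y (fun x => x = 0) -> (r <= n)%N.
Proof.
move=> yi; have /choice[s Hs] : forall i, exists s, s != 0 /\
    exists a, stalk_val (y i) * frac_const s = frac_const a.
  move=> i; have [d [a [s [_ /out_pt_neq0 s0 E]]]] := stalk_ex (y i).
  by exists s; split=> //; exists a.
have /choice[a Ha] : forall i, exists a,
  stalk_val (y i) * frac_const (s i) = frac_const a.
  by move=> i; case: (Hs i).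
apply: (@alg_indep_leq k n _ (@frac_const {mpoly k[n]}) _ r
   (fun i => stalk_val (y i)) (\prod_i s i) (fun i =>
     a i * \prod_(j | j != i) s j)).
- exact: frac_const_inj.
- by apply/prodf_neq0 => i _; case: (Hs i).
- by move=> i; rewrite (bigD1 i) //= !rmorphM /= -Ha; ring.
move=> F E; apply: yi; apply: val_inj => /=; rewrite -[RHS]E.
apply: (mpoly_rmorph_eq
  (f := val \o mmap (@stalk_const _ _ P \o @mpolyC n k) y)
  (g := mmap (@frac_const {mpoly k[n]} \o @mpolyC n k) (fun i =>
    stalk_val (y i)))) => [c|i] /=.
  by rewrite !mmapC.
by rewrite !mmapX !mmap1U.
Qed.

(** * Smoothness of the charts for disjoint complements of facets *)

Section Faces.
Variables (n : nat) (D : {set {set 'I_n}}).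
Hypothesis Dsc : simplicial_complex D.
Implicit Types A F G N : {set 'I_n}.

Definition min_nonface N := minset (fun F => F \notin D) N.

Lemma face_sub A F : A \subset F -> F \in D -> A \in D.
Proof. by case: Dsc => _ _ H AF FD; apply: H AF. Qed.

Lemma nonface_sub A F : A \subset F -> A \notin D -> F \notin D.
Proof. by move=> AF; apply: contra; apply: face_sub. Qed.

Lemma facet_face F : facet D F -> F \in D.
Proof. by case/maxsetP. Qed.

Lemma face_facet A : A \in D -> exists2 F, facet D F & A \subset F.
Proof. by move=> AD; have [F FF AF] := maxset_exists AD; exists F. Qed.

Lemma nonfaceP A F : A \notin D -> facet D F -> exists2 i, i \in A & i \notin F.
Proof.
by move=> AD FF; apply/subsetPn; apply: contra AD => /face_sub; apply;
  apply: facet_face.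
Qed.

Lemma nonface_facets A :
  (forall F, facet D F -> exists2 i, i \in A & i \notin F) -> A \notin D.
Proof.
move=> H; apply/negP => /face_facet[F FF /subsetP AF].
by have [i /AF iF] := H F FF; rewrite iF.
Qed.

Lemma min_nonfaceE N : min_nonface N -> N \notin D.
Proof. by case/minsetP. Qed.

Lemma min_nonface_eq N A : min_nonface N -> A \notin D -> A \subset N -> A = N.
Proof. by case/minsetP => _ H AD AN; apply: H. Qed.

Lemma ex_min_nonface A : A \notin D -> exists2 N, min_nonface N & N \subset A.
Proof. by move=> AD; have [N NM NA] := minset_exists (P := fun F =>
  F \notin D) AD; exists N. Qed.

Lemma min_nonface_facet N j : min_nonface N -> j \in N ->
  exists2 F, facet D F & N :\ j \subset F.
Proof.
move=> NM jN; apply: face_facet; apply: contraT => H.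
by have := min_nonface_eq NM H (subD1set _ _) => /setP/(_ j); rewrite !inE eqxx jN.
Qed.

Lemma min_nonface_facet_notin N j F : min_nonface N -> j \in N -> facet D F ->
  N :\ j \subset F -> j \notin F.
Proof.
move=> NM jN FF sub; have [i iN iF] := nonfaceP (min_nonfaceE NM) FF.
suff <- : i = j by [].
by apply/eqP; apply: contraNT iF => ij; apply: (subsetP sub); rewrite !inE ij.
Qed.

End Faces.

Section Transversal.
Variables (n : nat) (D : {set {set 'I_n}}).
Hypothesis Dsc : simplicial_complex D.
Hypothesis disj : forall F G : {set 'I_n}, facet D F -> facet D G -> F <> G ->
     F :|: G = [set: 'I_n].
Variables (N : {set 'I_n}) (NM : min_nonface D N).
Implicit Types A F G : {set 'I_n}.

Lemma facet_inj_notin F G i : facet D F -> facet D G -> i \notin F ->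
  i \notin G -> F = G.
Proof.
move=> FF GG iF iG; apply: contrapT => FG.
by have /setP/(_ i) := disj FF GG FG; rewrite !inE (negPf iF) (negPf iG).
Qed.

(** The index i can replace j in N; then x_i / x_j is the quotient of the monomial of the new
    nonface by x_N. *)
Definition swap i j := [&& i \notin N, j \in N & i |: N :\ j \notin D].

(** N leaves each facet G at some index. If it is not j, it survives the replacement; if it is j,
    then G = F by disjointness of the complements, and i lies outside F. *)
Lemma swap_facet F i j : facet D F -> j \in N -> j \notin F -> i \notin N ->
  i \notin F ->
  swap i j.
Proof.
move=> FF jN jF iN iF; rewrite /swap iN jN; apply: (nonface_facets) => G GG.
have [j' j'N j'G] := nonfaceP Dsc (min_nonfaceE NM) GG.
have [E|j'j] := eqVneq j' j; last by exists j'; rewrite ?inE ?j'j ?j'N ?orbT.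
exists i; first by rewrite !inE eqxx.
by rewrite -(facet_inj_notin FF GG jF) // -E.
Qed.

(** Facets F and G containing N minus j and N minus j' both avoid i, hence coincide; but j is
    outside F and, if j differs from j', inside G. *)
Lemma swap_uniq i j j' : swap i j -> swap i j' -> j = j'.
Proof.
move=> /and3P[iN jN ND] /and3P[_ j'N N'D]; apply/eqP; apply: contraT => jj'.
have [F FF NF] := min_nonface_facet NM jN.
have [G GG NG] := min_nonface_facet NM j'N.
have jF := min_nonface_facet_notin Dsc NM jN FF NF.
have jG := min_nonface_facet_notin Dsc NM j'N GG NG.
have i_notin H l : facet D H -> N :\ l \subset H -> i |: N :\ l \notin D ->
  i \notin H.
  move=> HH NH; apply: contra => iH; apply: (face_sub Dsc) (facet_face HH).
  by rewrite subUset sub1set iH.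
have E := facet_inj_notin FF GG (i_notin _ _ FF NF ND) (i_notin _ _ GG NG N'D).
case/negP: jF; rewrite E; apply: (subsetP NG); by rewrite !inE jj'.
Qed.

(** For each j in N take a facet containing N minus j and an element of A outside it. Distinct j
    have distinct facets, whose complements are disjoint, so the choice is injective. *)
Lemma nonface_transversal A : A \notin D -> exists f : 'I_n -> 'I_n,
  {in N &, injective f} /\ forall j,
    j \in N -> f j \in A /\ (f j = j \/ swap (f j) j).
Proof.
move=> AD; have /choice[f Hf] : forall j, exists i, j \in N -> exists F,
    [/\ facet D F, N :\ j \subset F, i \in A & i \notin F].
  move=> j; case: (boolP (j \in N)) => jN; last by exists j.
  have [F FF NF] := min_nonface_facet NM jN.
  have [i iA iF] := nonfaceP Dsc AD FF; exists i => _; by exists F.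
exists f; split=> [j j' jN j'N E|j jN].
  have [F [FF NF _ fF]] := Hf _ jN; have [G [GG NG _ fG]] := Hf _ j'N.
  rewrite -E in fG; have EFG := facet_inj_notin FF GG fF fG.
  apply/eqP; apply: contraNT (min_nonface_facet_notin Dsc NM jN FF NF) => jj'.
  by rewrite EFG; apply: (subsetP NG); rewrite !inE jj'.
have [F [FF NF fA fF]] := Hf _ jN; split=> //.
case: (boolP (f j \in N)) => fN.
  left; apply/eqP; apply: contraNT fF => fj; apply: (subsetP NF).
  by rewrite !inE fj.
by right; apply: (swap_facet FF) => //;
  apply: (min_nonface_facet_notin Dsc NM jN FF NF).
Qed.

End Transversal.

Lemma mpoly_ring_ind (R : comNzRingType) n (Q : {mpoly R[n]} -> Prop) :
    (forall c, Q c%:MP) -> (forall i, Q 'X_i) ->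
    (forall p q, Q p -> Q q -> Q (p + q)) -> (forall p q,
      Q p -> Q q -> Q (p * q)) ->
  forall p, Q p.
Proof.
move=> QC QX QD QM; elim/mpolyind => [|c m p _ _ Qp]; first by rewrite -mpolyC0.
apply: (QD) => //; rewrite -mul_mpolyC; apply: (QM) => //; rewrite mpolyXE_id.
elim/big_ind: _ => [||i _]; [by rewrite -mpolyC1 | exact: QM |].
by elim: (m i) => [|e IH]; [rewrite expr0 -mpolyC1 | rewrite exprS; apply: QM].
Qed.

Section SquarefreeMonomials.
Variables (k : fieldType) (n : nat) (D : {set {set 'I_n}}).
Local Notation R := {mpoly k[n]}.
Implicit Types A F G N : {set 'I_n}.

Definition xset A : R := \prod_(i in A) 'X_i.

Definition nonface_monomials : {pred R} :=
  fun f => `[< exists2 F : {set 'I_n}, F \notin D & f = \prod_(i in F) 'X_i >].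

Lemma stanley_reisnerE : stanley_reisner k D = gen_ideal nonface_monomials.
Proof. by []. Qed.

Lemma xset_setU1 A i : i \notin A -> xset (i |: A) = 'X_i * xset A.
Proof. by move=> iA; rewrite /xset big_setU1. Qed.

Lemma xset_setD1 A i : i \in A -> xset A = 'X_i * xset (A :\ i).
Proof. by move=> iA; rewrite /xset (big_setD1 i). Qed.

Lemma xset_setD A F : F \subset A -> xset A = xset F * xset (A :\: F).
Proof.
by move=> FA; rewrite /xset (big_setID F) /= (setIidPr FA).
Qed.

Lemma xset_mem A : A \notin D -> xset A \in stanley_reisner k D.
Proof. by move=> AD; apply/mem_gen_ideal/asboolP; exists A. Qed.

Lemma xset_neq0 A : xset A != 0.
Proof. by apply/prodf_neq0 => i _; rewrite -msize_poly_eq0 msizeX. Qed.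

Lemma ex_min_nonface_out (P : blowup (stanley_reisner k D)) :
  exists2 N, min_nonface D N & out_pt P 1 (xset N).
Proof.
have [x /asboolP[A AD ->] oA] := ex_generator_out P stanley_reisnerE.
have [N NM NA] := ex_min_nonface AD; exists N => //.
have [|//] := ptP P (ideal_exp1 (xset_mem (min_nonfaceE NM))).
move=> /(in_ptMl (ideal_exp0 _ (xset (A :\: N)))).
by rewrite mulrC -xset_setD // => /in_ptN_out/(_ oA).
Qed.

End SquarefreeMonomials.

(** * The chart of a minimal generator *)

Section Chart.
Variables (k : fieldType) (n : nat) (D : {set {set 'I_n}}).
Hypothesis Dsc : simplicial_complex D.
Hypothesis disj : forall F G : {set 'I_n}, facet D F -> facet D G -> F <> G ->
     F :|: G = [set: 'I_n].
Variables (P : blowup (stanley_reisner k D)) (N : {set 'I_n}).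
Hypotheses (NM : min_nonface D N) (oN : out_pt P 1 (xset k N)).
Local Notation R := {mpoly k[n]}.
Local Notation g := (xset k N).
Implicit Types A : {set 'I_n}.

(* On the chart of x_N the coordinates are x_i / x_j if i replaces j in N, and x_i
   otherwise. *)
Definition pivot (i : 'I_n) : option 'I_n := [pick j | swap D N i j].

Lemma pivotP i j : reflect (pivot i = Some j) (swap D N i j).
Proof.
rewrite /pivot; case: pickP => [j' s'|H]; last by rewrite H; constructor.
apply: (iffP idP) => [s|[<-//]]; congr Some.
exact: (swap_uniq Dsc disj NM) s' s.
Qed.

Lemma g_neq0 : frac_const g != 0.
Proof. by rewrite frac_const_eq0 xset_neq0. Qed.

Definition chart_val (i : 'I_n) : {fraction {poly R}} :=
  frac_const ('X_i : R) / oapp (fun j => frac_const ('X_j : R)) 1 (pivot i).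

Lemma X_neq0 (i : 'I_n) : frac_const ('X_i : R) != 0.
Proof. by rewrite frac_const_eq0 -msize_poly_eq0 msizeX. Qed.

Lemma chart_coord i : exists z : stalk P, stalk_val z = chart_val i.
Proof.
rewrite /chart_val; case Ep: (pivot i) => [j|] /=; last first.
  by exists (stalk_const P 'X_i); rewrite divr1.
have /pivotP/and3P[iN jN ND] := Ep.
have [z Ez] := stalk_mk (ideal_exp1 (xset_mem k ND)) oN; exists z; rewrite Ez.
rewrite xset_setU1 ?inE ?(negPf iN) ?andbF // (xset_setD1 k jN) !rmorphM /=.
by rewrite -mulf_div divff ?mulr1 // frac_const_eq0 xset_neq0.
Qed.

Definition chart_pt (i : 'I_n) : stalk P := projT1 (cid (chart_coord i)).

Lemma chart_ptE i : stalk_val (chart_pt i) = chart_val i.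
Proof. exact: projT2 (cid (chart_coord i)). Qed.

Definition chart : {rmorphism R -> stalk P} :=
  mmap (@stalk_const _ _ P \o @mpolyC n k) chart_pt.

(** The blowup morphism in chart coordinates: the function x_i on affine space is the coordinate x_i
    / x_j times x_j. *)
Definition blow_subst : {rmorphism R -> R} :=
  mmap (@mpolyC n k) (fun i : 'I_n => 'X_i * oapp (fun j : 'I_n =>
    'X_j) 1 (pivot i)).

Lemma chartX i : stalk_val (chart 'X_i) = chart_val i.
Proof. by rewrite /chart /= mmapX mmap1U chart_ptE. Qed.

Lemma chartC c : chart c%:MP = stalk_const P c%:MP.
Proof. by rewrite /chart /= mmapC. Qed.

Lemma blow_substC c : blow_subst c%:MP = c%:MP.
Proof. by rewrite /blow_subst /= mmapC. Qed.

Lemma blow_substX (i : 'I_n) :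
  blow_subst 'X_i = 'X_i * oapp (fun j : 'I_n => 'X_j) 1 (pivot i).
Proof. by rewrite /blow_subst /= mmapX mmap1U. Qed.

Lemma pivot_N j : j \in N -> pivot j = None.
Proof.
move=> jN; rewrite /pivot; case: pickP => // j' /and3P[].
by rewrite jN.
Qed.

Lemma blow_subst_xset A : A \subset N -> blow_subst (xset k A) = xset k A.
Proof.
move=> AN; rewrite rmorph_prod; apply: eq_bigr => i iA.
by rewrite blow_substX pivot_N ?mulr1 //; apply: (subsetP AN).
Qed.

(* Clearing denominators shows that blow_subst inverts the chart up to powers of
   g, so that the chart is injective. *)
Lemma chart_clear_denom (F : R) : exists d a,
  frac_const a = frac_const g ^+ d * stalk_val (chart F) /\
  blow_subst a = g ^+ d * F.
Proof.
elim/mpoly_ring_ind: F => [c|i|p q|p q].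
- exists 0%N, c%:MP; rewrite chartC !expr0 !mul1r; split=> //.
  exact: blow_substC.
- rewrite chartX /chart_val; case Ep: (pivot i) => [j|] /=; last first.
    exists 0%N, 'X_i; rewrite !expr0 !mul1r divr1; split=> //.
    by rewrite blow_substX Ep mulr1.
  have /pivotP/and3P[iN jN _] := Ep.
  exists 1%N, ('X_i * xset k (N :\ j)); rewrite !expr1; split.
    by rewrite (xset_setD1 k jN) !rmorphM /= [RHS]mulrC mulrA divfK ?X_neq0.
  rewrite rmorphM blow_substX Ep /= blow_subst_xset ?subD1set //.
  by rewrite (xset_setD1 k jN); ring.
- move=> [d [a [Ea Sa]]] [e [b [Eb Sb]]].
  exists (d + e)%N, (g ^+ e * a + g ^+ d * b); split.
    by rewrite !rmorphD !rmorphM !rmorphXn /= Ea Eb exprD; ring.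
  rewrite rmorphD !rmorphM !rmorphXn /= Sa Sb blow_subst_xset //.
  by rewrite exprD; ring.
move=> [d [a [Ea Sa]]] [e [b [Eb Sb]]].
exists (d + e)%N, (a * b); split; last by rewrite rmorphM Sa Sb exprD; ring.
by rewrite !rmorphM /= Ea Eb exprD; ring.
Qed.

Lemma chart_inj : injective chart.
Proof.
apply: raddf_inj => F F0; have [d [a [Ea Sa]]] := chart_clear_denom F.
move: Ea; rewrite F0 mulr0 -(rmorph0 (@frac_const R)) => /frac_const_inj a0.
move: Sa; rewrite a0 rmorph0 => /esym/eqP; rewrite mulf_eq0 expf_eq0.
by rewrite (negPf (xset_neq0 _ _)) andbF => /eqP.
Qed.

Definition in_chart (w : {fraction {poly R}}) := exists F, stalk_val (chart F) = w.

Lemma in_chartM w w' : in_chart w -> in_chart w' -> in_chart (w * w').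
Proof. by move=> [F <-] [G <-]; exists (F * G); rewrite rmorphM. Qed.

Lemma in_chartD w w' : in_chart w -> in_chart w' -> in_chart (w + w').
Proof. by move=> [F <-] [G <-]; exists (F + G); rewrite rmorphD. Qed.

Lemma in_chart1 : in_chart 1.
Proof. by exists 1; rewrite rmorph1. Qed.

Lemma in_chart0 : in_chart 0.
Proof. by exists 0; rewrite rmorph0. Qed.

Lemma in_chart_prod (T : Type) (r : seq T) (Q : pred T) (F : T -> {fraction {poly
  R}}) :
  (forall i, Q i -> in_chart (F i)) -> in_chart (\prod_(i <- r | Q i) F i).
Proof.
by move=> H; elim/big_ind: _ => //; [exact: in_chart1 | exact: in_chartM].
Qed.

Lemma in_chart_val i : in_chart (chart_val i).
Proof. by exists 'X_i; rewrite chartX. Qed.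

Lemma in_chart_const (x : R) : in_chart (frac_const x).
Proof.
elim/mpoly_ring_ind: x => [c|i|p q Hp Hq|p q Hp Hq].
- by exists c%:MP; rewrite chartC.
- case Ep: (pivot i) => [j|]; last first.
    by have := in_chart_val i; rewrite /chart_val Ep /= divr1.
  have := in_chartM (in_chart_val i) (in_chart_val j).
  have /pivotP/and3P[_ jN _] := Ep.
  by rewrite /chart_val Ep (pivot_N jN) /= divr1 divfK ?X_neq0.
- by rewrite rmorphD; apply: in_chartD.
by rewrite rmorphM; apply: in_chartM.
Qed.

(** By the transversal f, x_A / x_N is the product of the coordinates x_(f j) / x_j over j in N,
    times the remaining variables of A. *)
Lemma in_chart_nonface A : A \notin D -> in_chart (frac_const (xset k A) /
  frac_const g).
Proof.
move=> AD; have [f [f_inj fP]] := nonface_transversal Dsc disj NM AD.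
have fNA : f @: N \subset A by apply/subsetP => _ /imsetP[j /fP[fA _] ->].
rewrite (xset_setD k fNA) rmorphM mulrAC; apply: in_chartM;
  last exact: in_chart_const.
rewrite /xset big_imset //= !rmorph_prod -prodf_div; apply: in_chart_prod => j jN.
have [_ [->|/pivotP Ep]] := fP _ jN; first by rewrite divff ?X_neq0 //;
  apply: in_chart1.
by have := in_chart_val (f j); rewrite /chart_val Ep.
Qed.

Lemma in_chart_mem a : a \in stanley_reisner k D -> in_chart (frac_const a /
  frac_const g).
Proof.
move=> /asboolP[s sX ->]; rewrite rmorph_sum mulr_suml big_seq.
elim/big_ind: _ => [||p ps]; [exact: in_chart0 | exact: in_chartD |].
rewrite rmorphM -mulrA; apply: in_chartM; first exact: in_chart_const.
by have /asboolP[A AD ->] := sX _ ps; apply: in_chart_nonface.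
Qed.

Lemma in_chart_exp d a : a \in ideal_exp (stanley_reisner k D) d ->
  in_chart (frac_const a / frac_const g ^+ d).
Proof.
move=> /asboolP[s sX ->]; rewrite rmorph_sum mulr_suml big_seq.
elim/big_ind: _ => [||p ps]; [exact: in_chart0 | exact: in_chartD |].
rewrite rmorphM -mulrA; apply: in_chartM; first exact: in_chart_const.
have /asboolP[b Ib ->] := sX _ ps.
have -> : frac_const g ^+ d = \prod_(j < d) frac_const g by rewrite prodr_const
  card_ord.
by rewrite rmorph_prod -prodf_div; apply: in_chart_prod => j _; apply: in_chart_mem.
Qed.

(** Write a / s as (a / g^d) / (s / g^d). Both are polynomials in the coordinates, and g^d / s
    belongs to the stalk because s t^d is outside the prime. *)
Lemma chart_localization (b : stalk P) :
  exists a s s', chart s * s' = 1 /\ b * chart s = chart a.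
Proof.
have [d [a [s [Ia os E]]]] := stalk_ex b.
have [fa Efa] := in_chart_exp Ia; have [fs Efs] := in_chart_exp (out_pt_mem os).
have gd : g ^+ d \in ideal_exp (stanley_reisner k D) d.
  by have := out_pt_mem (out_ptX d oN); rewrite muln1.
have [z Ez] := stalk_mk gd os; exists fa, fs, z; split; apply: val_inj => /=.
  rewrite Efs Ez rmorphXn /= mulrA divfK ?divff // ?frac_const_eq0 ?(out_pt_neq0
    os) //.
  by rewrite expf_neq0 // g_neq0.
by rewrite Efa Efs mulrA E.
Qed.

Lemma chart_regular : regular_local (stalk P).
Proof.
apply: (@regular_local_localization _ _ (stalk_max_prime P) (@stalk_unit _ _ P) k
  n chart).
- exact: chart_inj.
- exact: chart_localization.
move=> r y yi; apply: (stalk_alg_indep_leq (y := y)) => F E; apply: yi.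
rewrite -[RHS]E; apply: eq_bigr => m _; congr (_ * _).
by rewrite /= chartC.
Qed.

End Chart.

(** * Tangent vectors at the vertices *)

Section Coefficients.
Variables (R : comNzRingType) (n : nat).
Implicit Types (p q : {mpoly R[n]}) (m k l : 'X_{1..n}).

Lemma eq_big_supp (T : eqType) (s t : seq T) (F : T -> R) : uniq s -> uniq t ->
    (forall x, F x != 0 -> (x \in s) && (x \in t)) ->
  \sum_(x <- s) F x = \sum_(x <- t) F x.
Proof.
move=> us ut FP.
have E (r : seq T) : \sum_(x <- r) F x = \sum_(x <- r | F x != 0) F x.
  by rewrite [RHS]big_mkcond; apply: eq_bigr => x _; case: eqP.
rewrite (E s) (E t) -big_filter -[RHS]big_filter; apply: perm_big.
apply: uniq_perm; rewrite ?filter_uniq // => x; rewrite !mem_filter.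
by have := FP x; case: (F x != 0) => // /(_ isT)/andP[-> ->].
Qed.

Lemma mcoeff_mul_neq0 p q m : (p * q)@_m != 0 ->
  exists k l, [/\ p@_k != 0, q@_l != 0 & m = (k + l)%MM].
Proof.
rewrite -mcoeff_msupp => /msuppM_le/allpairsP[[k l] /= [pk ql ->]].
by exists k, l; rewrite -!mcoeff_msupp.
Qed.

Lemma mcoeffMXl p k l : ('X_[k] * p)@_(k + l) = p@_l.
Proof. by rewrite mulrC mcoeffMX. Qed.

(** Restricts the convolution to a list of pairs containing all contributing ones: one pair for
    multiplicativity at the vertex, two for the Leibniz rule. *)
Lemma mcoeffM_supp p q m (ks : seq ('X_{1..n} * 'X_{1..n})) :
    uniq (map fst ks) -> {in ks, forall kl, (kl.1 + kl.2)%MM = m} ->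
    (forall k l, p@_k != 0 -> q@_l != 0 -> (k + l)%MM = m -> k \in map fst ks) ->
  (p * q)@_m = \sum_(kl <- ks) p@_kl.1 * q@_kl.2.
Proof.
move=> uks mks H.
rewrite {1}[p]mpolyE mulr_suml raddf_sum /=.
transitivity (\sum_(k <- map fst ks) p@_k * ('X_[k] * q)@_m).
  rewrite -(eq_big_supp (s := msupp p) (F := fun k => p@_k * ('X_[k] * q)@_m)) //.
    by apply: eq_bigr => k _; rewrite -scalerAl mcoeffZ.
  move=> k nz; have pk : p@_k != 0.
    by apply: contra_neq nz => ->; rewrite mul0r.
  rewrite mcoeff_msupp pk /=.
  have : ('X_[k] * q)@_m != 0 by apply: contra_neq nz => ->; rewrite mulr0.
  move=> /mcoeff_mul_neq0[k' [l [+ ql ml]]]; rewrite mcoeffX mulrb.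
  case: (k =P k') => [ek _|_]; last by rewrite eqxx.
  by apply: (H k l) => //; rewrite ml ek.
rewrite big_map [LHS]big_seq [RHS]big_seq; apply: eq_bigr => kl /mks <-.
by rewrite mcoeffMXl.
Qed.

End Coefficients.

(** * Monomials of the powers of the ideal, and the vertex point *)

Section Covers.
Variables (k : fieldType) (n : nat) (D : {set {set 'I_n}}).
Local Notation R := {mpoly k[n]}.
Local Notation I := (stanley_reisner k D).
Implicit Types (A F : {set 'I_n}) (u v w : 'X_{1..n}).

Definition mset A : 'X_{1..n} := [multinom (i \in A : nat) | i < n].

Lemma xsetE A : xset k A = 'X_[mset A].
Proof.
rewrite mpolyXE_id /xset big_mkcond; apply: eq_bigr => i _.
by rewrite mnmE; case: (i \in A); rewrite ?expr1 ?expr0.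
Qed.

(* The combinatorial form of 'X_[u] \in I^d. *)
Definition cover d u := exists2 s : seq {set 'I_n},
  size s = d /\ {in s, forall A, min_nonface D A}
  & forall i, (count (fun A => i \in A) s <= u i)%N.

Lemma coverD d e u v : cover d u -> cover e v -> cover (d + e) (u + v).
Proof.
move=> [s [sd sM] su] [t [te tM] tv]; exists (s ++ t); first split.
- by rewrite size_cat sd te.
- by move=> A; rewrite mem_cat => /orP[/sM|/tM].
by move=> i; rewrite count_cat mnmDE leq_add.
Qed.

Lemma cover0 u : cover 0 u.
Proof. by exists [::]. Qed.

Lemma cover1 A u : A \notin D -> (forall i, i \in A -> (0 < u i)%N) -> cover 1 u.
Proof.
move=> /ex_min_nonface[N NM /subsetP NA] Au; exists [:: N]; first split=> //.
  by move=> F; rewrite inE => /eqP->.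
by move=> i; rewrite /= addn0; case: (boolP (i \in N)) => // /NA/Au.
Qed.

Definition supp_cover d (a : R) := forall u, a@_u != 0 -> cover d u.

Lemma supp_coverM d e a b : supp_cover d a -> supp_cover e b -> supp_cover (d +
  e) (a * b).
Proof.
move=> ca cb u /mcoeff_mul_neq0[v [w [av bw ->]]].
by apply: coverD; [apply: ca | apply: cb].
Qed.

Lemma supp_cover_sum (T : Type) (r : seq T) (Q : pred T) d (F : T -> R) :
  (forall i, Q i -> supp_cover d (F i)) -> supp_cover d (\sum_(i <- r | Q i) F i).
Proof.
move=> H; elim/big_ind: _ => //.
  by move=> u; rewrite mcoeff0 eqxx.
move=> a b ca cb u; rewrite mcoeffD.
have [->|/ca //] := eqVneq a@_u 0.
by rewrite add0r; apply: cb.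
Qed.

Lemma supp_cover_mem a : a \in I -> supp_cover 1 a.
Proof.
move=> /asboolP[s sX ->]; rewrite big_seq; apply: supp_cover_sum => p ps.
rewrite -[1%N]add0n; apply: supp_coverM; first by move=> u _; apply: cover0.
have /asboolP[A AD ->] := sX _ ps; move=> u.
rewrite -/(xset k A) xsetE mcoeffX mulrb; case: (_ =P u) => [<- _|_];
  last by rewrite eqxx.
by apply: (cover1 AD) => i iA; rewrite mnmE iA.
Qed.

Lemma supp_cover_exp d a : a \in ideal_exp I d -> supp_cover d a.
Proof.
move=> /asboolP[s sX ->]; rewrite big_seq; apply: supp_cover_sum => p ps.
rewrite -[d]add0n; apply: supp_coverM; first by move=> u _; apply: cover0.
have /asboolP[b Ib ->] := sX _ ps.
elim: d b Ib {s sX p ps} => [|d IH] b Ib; first by move=> u _; apply: cover0.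
rewrite big_ord_recl; apply: (@supp_coverM 1 d); first exact: supp_cover_mem.
exact: IH.
Qed.

Lemma cover1_mem w : cover 1 w -> 'X_[w] \in I.
Proof.
case=> s [s1 AM] Aw; case: s s1 AM Aw => [|A [|]] // _ AM Aw.
have Aw' : (mset A <= w)%MM.
  by apply/mnm_lepP => i; have := Aw i; rewrite /= addn0 mnmE.
rewrite -(submK Aw') mpolyXD -xsetE; apply: gen_idealMl; apply: xset_mem.
by apply: min_nonfaceE; apply: AM; rewrite mem_head.
Qed.

Section Vertex.
Variables (N : {set 'I_n}) (NM : min_nonface D N).
Local Notation G := (mset N).

Lemma min_nonface_subE A : min_nonface D A -> A \subset N -> A = N.
Proof. by move=> AM; apply: (min_nonface_eq NM (min_nonfaceE AM)). Qed.

Lemma count_constN (s : seq {set 'I_n}) i :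
  {in s, forall A, A = N} -> count (fun A => i \in A) s = ((i \in N) * size s)%N.
Proof.
elim: s => [|A s IH] sN /=; first by rewrite muln0.
rewrite IH => [|B sB]; last by apply: sN; rewrite inE sB orbT.
by rewrite (sN A) ?mem_head // mulnS.
Qed.

(** No variable outside N occurs, so every minimal nonface in either cover is contained in N, hence
    equal to N. Thus u and v dominate d and e copies of N, and their sum leaves no excess. *)
Lemma cover_vertex d e u v : cover d u -> cover e v ->
  (u + v)%MM = (G *+ (d + e))%MM -> u = (G *+ d)%MM.
Proof.
move=> [s [sd sM] su] [t [te tM] tv] /mnmP uv.
have sN A : A \in s ++ t -> A = N.
  move=> stA; apply: min_nonface_subE.
    by move: stA; rewrite mem_cat => /orP[/sM|/tM].
  apply/subsetP => i iA; have := uv i; rewrite mnmDE mulmnE mnmE.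
  have := su i; have := tv i;
    have : (0 < count (fun B : {set 'I_n} => i \in B) (s ++ t))%N.
    by rewrite -has_count; apply/hasP; exists A.
  by rewrite count_cat; case: (i \in N) => //; lia.
apply/mnmP => i; rewrite mulmnE mnmE.
have := uv i; have := su i; have := tv i; rewrite mnmDE mulmnE mnmE.
rewrite !count_constN ?sd ?te; first by case: (i \in N); rewrite ?mul0n ?mul1n; lia.
- by move=> A sA; apply: sN; rewrite mem_cat sA.
- by move=> A tA; apply: sN; rewrite mem_cat tA orbT.
Qed.

Lemma mcoeff_vertexM d e (a b : R) : supp_cover d a -> supp_cover e b ->
  (a * b)@_(G *+ (d + e)) = a@_(G *+ d) * b@_(G *+ e).
Proof.
move=> ca cb; rewrite (@mcoeffM_supp _ _ _ _ _ [:: (G *+ d,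
  G *+ e)%MM]) ?big_seq1 //.
  by move=> kl; rewrite inE => /eqP->; apply/mnmP => i;
    rewrite mnmDE !mulmnE mulnDr.
move=> u v /ca cu /cb cv /(cover_vertex cu cv) ->.
by rewrite inE.
Qed.

(* Reads off the coefficient of x_N^d in each degree d; this is multiplicative
   because x_N is a vertex of the Newton polyhedron of I. *)
Definition vertex_eval (f : rees I) : {poly k} :=
  \poly_(d < size (f : {poly R})) (f : {poly R})`_d@_(G *+ d).

Lemma coef_vertex_eval f d : (vertex_eval f)`_d = (f : {poly R})`_d@_(G *+ d).
Proof.
by rewrite coef_poly; case: ltnP => // fd; rewrite nth_default ?mcoeff0.
Qed.

Lemma vertex_eval_zmod : zmod_morphism vertex_eval.
Proof.
by move=> f g; apply/polyP => d;
  rewrite coefB !coef_vertex_eval rees_valB coefB mcoeffB.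
Qed.

Lemma vertex_eval_monoid : monoid_morphism vertex_eval.
Proof.
split=> [|f g]; apply/polyP => d.
  rewrite coef_vertex_eval rees_val1 !coef1; case: d => [|d];
    last by rewrite mcoeff0.
  by rewrite mulm0n mcoeff1 eqxx.
rewrite coef_vertex_eval rees_valM !coefM raddf_sum; apply: eq_bigr => j _ /=.
have := mcoeff_vertexM (supp_cover_exp (reesP f j)) (supp_cover_exp (reesP g (d -
  j)%N)).
have jd : (j <= d)%N by rewrite -ltnS.
by rewrite subnKC // !coef_vertex_eval.
Qed.

HB.instance Definition _ := GRing.isZmodMorphism.Build _ _ vertex_eval
  vertex_eval_zmod.
HB.instance Definition _ := GRing.isMonoidMorphism.Build _ _ vertex_eval
  vertex_eval_monoid.

Lemma vertex_prime : is_prime (fun f => vertex_eval f = 0).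
Proof. exact: (is_prime_preim vertex_eval (is_prime_zero {poly k})). Qed.

Lemma vertex_homog : homog_ideal (prime_idealr_of vertex_prime).
Proof.
move=> f d /prime_predP f0; apply/prime_predP/polyP => e.
rewrite coef0 coef_vertex_eval /= coefZ coefXn; case: eqP => [->|_].
  by rewrite mulr1 -coef_vertex_eval f0 coef0.
by rewrite mulr0 mcoeff0.
Qed.

Lemma vertex_monomialP d (a : R) (f : rees I) : (f : {poly R}) = a *: 'X^d ->
  reflect (a@_(G *+ d) = 0) (f \in prime_pred vertex_prime).
Proof.
move=> Ef; apply: (iffP (prime_predP _ _)) => [/polyP/(_ d)|a0].
  by rewrite coef0 coef_vertex_eval Ef coefZ coefXn eqxx mulr1.
apply/polyP => e; rewrite coef0 coef_vertex_eval Ef coefZ coefXn.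
by case: eqP => [->|_]; rewrite ?mulr1 // mulr0 mcoeff0.
Qed.

Lemma xsetN_coef : (xset k N)@_(G *+ 1) = 1.
Proof. by rewrite xsetE mcoeffX mulm1n eqxx. Qed.

Lemma vertex_relevant : ~ {subset irrelevant (I := I) <= prime_pred vertex_prime}.
Proof.
pose f := rees_monomial (ideal_exp1 (xset_mem k (min_nonfaceE NM))).
move=> /(_ f) H.
have Ef : (f : {poly R}) = xset k N *: 'X^1 by [].
have /(vertex_monomialP Ef)/eqP : f \in prime_pred vertex_prime.
  apply: H; rewrite unfold_in; apply/eqP; apply: val_inj => /=.
  by rewrite coefZ coefXn mulr0 scale0r.
by rewrite xsetN_coef oner_eq0.
Qed.

Definition vertex_pt : blowup I := Blowup vertex_homog vertex_relevant.
Local Notation P := vertex_pt.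

Lemma vertex_in d a : in_pt P d a -> a@_(G *+ d) = 0.
Proof. by case=> f Pf Ef; apply/(vertex_monomialP Ef). Qed.

Lemma vertex_outN d a : out_pt P d a -> a@_(G *+ d) != 0.
Proof. by case=> f Pf Ef; apply: contraNneq Pf => a0;
  apply/(vertex_monomialP Ef). Qed.

Lemma vertex_outP d a : a \in ideal_exp I d -> a@_(G *+ d) != 0 -> out_pt P d a.
Proof. by move=> /ptP-/(_ P)[/vertex_in->|//]; rewrite eqxx. Qed.

(** In the chart: w / x_N is not 1, and whenever it is a product u / x_N^(d+1) times v / x_N^(e+1)
    of chart monomials, one factor is 1. *)
Definition indecomposable w := [/\ w != G, cover 1 w &
  forall d e u v, cover d.+1 u -> cover e.+1 v ->
    (u + v)%MM = (G *+ (d + e).+1 + w)%MM ->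
    u = (G *+ d.+1)%MM \/ v = (G *+ e.+1)%MM].

Section Derivation.
Variables (w : 'X_{1..n}) (Iw : indecomposable w).
(** For a of degree d + 1, not d: the coefficient of w / x_N in a / x_N^(d+1). *)
Definition der_coef d (a : R) : k := a@_(G *+ d + w).

(** Leibniz rule: by indecomposability only two pairs of monomials contribute, and they are distinct
    because w is not x_N. *)
Lemma der_coefM d e a b : supp_cover d.+1 a -> supp_cover e.+1 b ->
  der_coef (d + e).+1 (a * b) =
  a@_(G *+ d.+1) * der_coef e b + der_coef d a * b@_(G *+ e.+1).
Proof.
move=> ca cb; have [wG _ Iw'] := Iw.
pose k1 := (G *+ d.+1, G *+ e + w)%MM; pose k2 := (G *+ d + w, G *+ e.+1)%MM.
rewrite /der_coef (@mcoeffM_supp _ _ _ _ _ [:: k1; k2]).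
- by rewrite big_cons big_seq1.
- rewrite /= inE andbT; apply: contra wG => /eqP/mnmP E; apply/eqP/mnmP => i.
  by have := E i; rewrite mnmDE !mulmnE; lia.
- move=> kl; rewrite !inE => /orP[]/eqP->; apply/mnmP => i;
  rewrite !mnmDE !mulmnE; lia.
move=> u v /ca cu /cb cv E; rewrite !inE.
case: (Iw' _ _ _ _ cu cv E) => [->|Ev]; first by rewrite eqxx.
apply/orP; right; apply/eqP/mnmP => i; have /mnmP/(_ i) := E.
by rewrite Ev !mnmDE !mulmnE; lia.
Qed.

End Derivation.

(** Numerator and denominator are multiplied by x_N to reach positive degree, where [der_coef] makes
    sense. *)
Lemma vertex_ex (z : stalk P) : exists d a s,
  [/\ supp_cover d.+1 a, supp_cover d.+1 s, s@_(G *+ d.+1) != 0 &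
      stalk_val z * frac_const s = frac_const a].
Proof.
have [d [a [s [Ia os E]]]] := stalk_ex z.
have I1 := ideal_exp1 (xset_mem k (min_nonfaceE NM)).
have c1 := supp_cover_exp I1; have cs := supp_cover_exp (out_pt_mem os).
exists d, (xset k N * a), (xset k N * s); rewrite -add1n; split.
- by apply: supp_coverM => //; apply: supp_cover_exp.
- exact: supp_coverM.
- by rewrite mcoeff_vertexM // xsetN_coef mul1r; apply: vertex_outN.
by rewrite !rmorphM /= -E mulrCA.
Qed.

Lemma vertex_max0 (z : stalk P) d a s : stalk_max z ->
    supp_cover d a -> supp_cover d s -> s@_(G *+ d) != 0 ->
    stalk_val z * frac_const s = frac_const a ->
  a@_(G *+ d) = 0.
Proof.
move=> [e [b [t [/[dup] ib /vertex_in b0 /[dup] ot /vertex_outN t0 E]]]] ca cs s0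
  E'.
have := congr1 (mcoeff (G *+ (d + e))) (stalk_frac_eq E' E).
rewrite mcoeff_vertexM //; last exact/supp_cover_exp/out_pt_mem/ot.
rewrite addnC mcoeff_vertexM //; last exact/supp_cover_exp/in_pt_mem/ib.
by rewrite b0 mul0r => /eqP; rewrite mulf_eq0 (negPf t0) orbF => /eqP.
Qed.

(** Apply the Leibniz rule to a t = b s: the coefficients of a and b at the vertex vanish on the
    maximal ideal, which leaves a single term on each side. *)
Lemma der_unique w (z : stalk P) d a s e b t : indecomposable w -> stalk_max z ->
    supp_cover d.+1 a -> supp_cover d.+1 s -> s@_(G *+ d.+1) != 0 ->
    stalk_val z * frac_const s = frac_const a ->
    supp_cover e.+1 b -> supp_cover e.+1 t -> t@_(G *+ e.+1) != 0 ->
    stalk_val z * frac_const t = frac_const b ->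
  der_coef w d a / s@_(G *+ d.+1) = der_coef w e b / t@_(G *+ e.+1).
Proof.
move=> Iw mz ca cs s0 E cb ct t0 E'.
have a0 := vertex_max0 mz ca cs s0 E; have b0 := vertex_max0 mz cb ct t0 E'.
have := congr1 (der_coef w (d + e).+1) (stalk_frac_eq E E').
rewrite (der_coefM Iw ca ct) addnC (der_coefM Iw cb cs) a0 b0 !mul0r !add0r => H.
by apply/eqP; rewrite eqr_div // H.
Qed.

Lemma vertex_dim d : krull_dim (stalk P) d -> (d <= n)%N.
Proof.
move=> [[c /prime_chain_tower [cP cS]] _].
pose i0 : 'I_0 -> stalk P := fun _ => 0.
have [y yi] := chain_alg_indep cP cS
  (alg_indep0 (iota := @stalk_const _ _ P \o @mpolyC n k) (z := i0) (cP d (leqnn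
    d))).
suff : (d + 0 <= n)%N by rewrite addn0.
refine (@stalk_alg_indep_leq k n I P (d + 0) y _) => F F0; apply: yi.
by rewrite F0; apply: (is_prime0 (cP 0%N (leq0n d))).
Qed.

(* Indecomposable monomials give independent tangent vectors at the vertex. *)
Lemma vertex_regular_bound r (W : 'I_r -> 'X_{1..n}) :
    regular_local (stalk P) -> injective W -> (forall i, indecomposable (W i)) ->
  (r <= n)%N.
Proof.
move=> [_ [m' [m'max _ [d /vertex_dim dn [s sd Es]]]]] W_inj WI.
have m'E := local_unique (stalk_max_prime P) (@stalk_unit _ _ P) m'max.
have mP := stalk_max_prime P.
apply: leq_trans dn.
(* One representation is fixed for each element; on the maximal ideal [der] does not depend on it.
   [val0] is the value at the point. *)
have /choice[rep Hrep] : forall z : stalk P, exists q : nat * R * R,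
    [/\ supp_cover q.1.1.+1 q.1.2, supp_cover q.1.1.+1 q.2,
      q.2@_(G *+ q.1.1.+1) != 0 &
      stalk_val z * frac_const q.2 = frac_const q.1.2].
  by move=> z; have [e [a [t H]]] := vertex_ex z; exists (e, a, t).
pose val0 z := (rep z).1.2@_(G *+ (rep z).1.1.+1) / (rep z).2@_(G *+ (rep
  z).1.1.+1).
pose der w z := der_coef w (rep z).1.1 (rep z).1.2 / (rep z).2@_(G *+ (rep
  z).1.1.+1).
have derE w z e a t : indecomposable w -> stalk_max z ->
    supp_cover e.+1 a -> supp_cover e.+1 t -> t@_(G *+ e.+1) != 0 ->
    stalk_val z * frac_const t = frac_const a ->
    der w z = der_coef w e a / t@_(G *+ e.+1).
  move=> Iw mz ca ct t0 E; have [cb cu u0 E'] := Hrep z.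
  exact: (der_unique Iw mz cb cu u0 E').
(* The other Leibniz term carries the value of z at the point, which is 0. *)
have derM w h z : indecomposable w -> stalk_max z -> der w (h * z) = val0 h * der
  w z.
  move=> Iw mz; have [ca cs s0 E] := Hrep z; have [cb ct t0 E'] := Hrep h.
  rewrite /val0 /der -/(der w (h * z)).
  rewrite (derE w (h * z) ((rep h).1.1 + (rep z).1.1).+1
     ((rep h).1.2 * (rep z).1.2) ((rep h).2 * (rep z).2)) //.
  - rewrite (der_coefM Iw cb ca) -addSn -addnS mcoeff_vertexM //.
    rewrite (vertex_max0 mz ca cs s0 E) mulr0 addr0.
    by rewrite mulf_div.
  - exact: is_primeMl.
  - by rewrite -addSn -addnS; apply: supp_coverM.
  - by rewrite -addSn -addnS; apply: supp_coverM.
  - by rewrite -addSn -addnS mcoeff_vertexM // mulf_neq0.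
  by rewrite !rmorphM /= -E -E'; ring.
have derD w z z' : indecomposable w -> stalk_max z -> stalk_max z' ->
    der w (z + z') = der w z + der w z'.
  move=> Iw mz mz'; have [ca cs s0 E] := Hrep z; have [cb ct t0 E'] := Hrep z'.
  have a0 := vertex_max0 mz ca cs s0 E; have b0 := vertex_max0 mz' cb ct t0 E'.
  rewrite (derE w (z + z') ((rep z).1.1 + (rep z').1.1).+1
     ((rep z).1.2 * (rep z').2 + (rep z).2 * (rep z').1.2) ((rep z).2 * (rep
       z').2)) //.
  - rewrite /der_coef mcoeffD -!/(der_coef _ _ _) !der_coefM // -addSn -addnS
    mcoeff_vertexM //.
    rewrite a0 b0 mul0r add0r mulr0 addr0 mulrDl /der; congr (_ + _).
      by rewrite -mulf_div divff // mulr1.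
    by rewrite -mulf_div divff // mul1r.
  - exact: is_primeD.
  - rewrite -addSn -addnS => u; rewrite mcoeffD.
    have [->|nz _] := eqVneq ((rep z).1.2 * (rep z').2)@_u 0;
      last exact: supp_coverM nz.
    by rewrite add0r; apply: supp_coverM.
  - by rewrite -addSn -addnS; apply: supp_coverM.
  - by rewrite -addSn -addnS mcoeff_vertexM // mulf_neq0.
  by rewrite rmorphD !rmorphM /= -E -E'; ring.
have der_sum w (T : finType) (F : T -> stalk P) : indecomposable w ->
    (forall i, stalk_max (F i)) -> der w (\sum_i F i) = \sum_i der w (F i).
  move=> Iw Fm; suff [] : stalk_max (\sum_i F i) /\ der w (\sum_i F i) = \sum_i
    der w (F i) by [].
  elim/big_rec2: _ => [|i x y _ [my <-]]; last first.
    by split; [apply: is_primeD | rewrite derD].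
  have m0 : stalk_max (0 : stalk P) by exact: is_prime0.
  split=> //; have /eqP := derD w 0 0 Iw m0 m0.
  by rewrite addr0 -subr_eq0 opprD addrA subrr add0r oppr_eq0 => /eqP.
have oN : out_pt P 1 (xset k N).
  apply: vertex_outP; last by rewrite xsetN_coef oner_eq0.
  exact/ideal_exp1/xset_mem/min_nonfaceE.
(* The elements x_(W i) / x_N of the maximal ideal, to which the forms [der (W j)] are dual. *)
have /choice[z Hz] : forall i, exists z : stalk P,
    stalk_val z * frac_const (xset k N) = frac_const 'X_[W i].
  move=> i; have [_ cW _] := WI i.
  have [z Ez] := stalk_mk (ideal_exp1 (cover1_mem cW)) oN.
  by exists z; rewrite Ez divfK // frac_const_eq0 xset_neq0.
have cX i : supp_cover 1 ('X_[W i] : R).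
  by have [_ cW _] := WI i; apply: supp_cover_mem; apply: cover1_mem.
have zm i : stalk_max (z i).
  exists 1%N, 'X_[W i], (xset k N); split=> //.
  have [WG cW _] := WI i.
  have [//|/vertex_outN] := ptP P (ideal_exp1 (cover1_mem cW)).
  by rewrite mulm1n mcoeffX (negPf WG) eqxx.
have der_z i j : der (W j) (z i) = (i == j)%:R.
  rewrite (derE (W j) (z i) 0%N 'X_[W i] (xset k N)) //.
  - rewrite xsetN_coef divr1 /der_coef mulm0n add0m mcoeffX.
    by rewrite (inj_eq W_inj).
  - exact/supp_cover_exp/out_pt_mem/oN.
  by rewrite xsetN_coef oner_eq0.
have sm (l : 'I_(size s)) : stalk_max s`_l.
  by apply/(prime_predP mP); rewrite -m'E Es mem_gen_seq // mem_nth.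
have /choice[h Hh] : forall i, exists h : 'I_(size s) -> stalk P,
    z i = \sum_l h l * s`_l.
  by move=> i; apply: gen_ideal_seqP; rewrite -Es m'E; apply/prime_predP.
(* Expressing the z_i by the generators of the maximal ideal factors the identity matrix of size r
   through their number. *)
pose H : 'M[k]_(r, size s) := \matrix_(i, l) val0 (h i l).
pose M : 'M[k]_(size s, r) := \matrix_(l, j) der (W j) s`_l.
have HM : H *m M = 1%:M.
  apply/matrixP => i j; rewrite !mxE -der_z Hh der_sum //; last first.
    by move=> l; apply: is_primeMl.
  by apply: eq_bigr => l _; rewrite !mxE derM.
by rewrite -sd -{1}(mxrank1 k r) -HM (leq_trans (mxrankM_maxl _ _)) ?rank_leq_col.
Qed.
End Vertex.
End Covers.

(** * Exchange properties of minimal nonfaces *)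

Section Indecomposables.
Variables (n : nat) (D : {set {set 'I_n}}) (N : {set 'I_n}).
Hypothesis NM : min_nonface D N.
Implicit Types (A B F : {set 'I_n}) (s t : seq {set 'I_n}) (w : 'X_{1..n}).
Local Notation G := (mset N).
Local Notation cnt i s := (count (fun A : {set 'I_n} => i \in A) s).

Lemma cnt_gt0 A s i : A \in s -> i \in A -> (0 < cnt i s)%N.
Proof. by move=> sA iA; rewrite -has_count; apply/hasP; exists A. Qed.

Lemma min_nonfaceNsub A : min_nonface D A -> A <> N -> exists2 i,
  i \in A & i \notin N.
Proof.
by move=> AM AN; apply/subsetPn; apply: contra_notN AN => /(min_nonface_subE NM AM).
Qed.

Lemma mset_neq A : A <> N -> mset A != G.
Proof.
move=> AN; apply: contra_notN AN => /eqP/mnmP E; apply/setP => i.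
by have := E i; rewrite !mnmE; case: (i \in A); case: (i \in N).
Qed.

(* In a product of m + 1 generators dividing x_N^m x_A, some factor other than
   x_N agrees with x_A outside N; all the others must then be x_N. *)
Lemma mset_indecomposable A : min_nonface D A -> A <> N ->
    (forall s m, size s = m.+1 -> {in s, forall B, min_nonface D B} ->
       (forall i, cnt i s <= (i \in N) * m + (i \in A))%N ->
       exists2 B, B \in s & B :\: N = A :\: N) ->
  indecomposable D N (mset A).
Proof.
move=> AM AN H; split; first exact: mset_neq.
  by apply: (cover1 (min_nonfaceE AM)) => i iA; rewrite mnmE iA.
(* Once B has used up the part of x_A outside N, every other factor is supported in N, so it is N.
   Then B is contained in A, so B = A and v has nothing beyond its copies of N. *)
have half d e (u v : 'X_{1..n}) s t B : size s = d.+1 -> {in s, forall B,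
  min_nonface D B} ->
    size t = e.+1 -> {in t, forall B, min_nonface D B} ->
    (forall i, cnt i s <= u i)%N -> (forall i, cnt i t <= v i)%N ->
    (u + v)%MM = (G *+ (d + e).+1 + mset A)%MM ->
    B \in s -> B :\: N = A :\: N -> v = (G *+ e.+1)%MM.
  move=> sd sM te tM su tv /mnmP uv sB /setP BA.
  have [s1 [s2 Es]] : exists s1 s2, s = s1 ++ B :: s2.
    by case/splitPr: sB => s1 s2; exists s1, s2.
  have others C : C \in s1 ++ s2 ++ t -> C = N.
    move=> HC; apply: (min_nonface_subE NM).
      move: HC; rewrite !mem_cat => /or3P[]HC; last exact: tM.
        by apply: sM; rewrite Es mem_cat HC.
      by apply: sM; rewrite Es mem_cat inE HC !orbT.
    apply/subsetP => i iC; have := uv i; rewrite mnmDE mnmDE mulmnE !mnmE.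
    have := su i; have := tv i; have := BA i; have := cnt_gt0 HC iC.
    rewrite Es !inE !count_cat /=.
    by case: (i \in N); case: (i \in B); case: (i \in A) => //=; lia.
  have ct i : cnt i t = ((i \in N) * e.+1)%N.
    by rewrite (count_constN (N := N)) ?te // => C tC; apply: others;
      rewrite !mem_cat tC !orbT.
  have cs i : cnt i s = ((i \in B) + (i \in N) * d)%N.
    rewrite Es count_cat /= addnCA -count_cat (count_constN (N := N)).
      congr (_ + _ * _)%N; move: sd; rewrite Es !size_cat /= addnS => -[].
      by [].
    by move=> C; rewrite mem_cat => HC; apply: others;
      rewrite catA mem_cat mem_cat HC.
  have BAs : B \subset A.
    apply/subsetP => i iB; have := uv i; rewrite mnmDE mnmDE mulmnE !mnmE.
    have := su i; have := tv i; rewrite cs ct iB.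
    by case: (i \in N); case: (i \in A) => //=; rewrite ?mul0n ?mul1n; lia.
  have BE : B = A.
    apply: (min_nonface_eq AM _ BAs); apply: min_nonfaceE; exact: sM.
  apply/mnmP => i; have := uv i; rewrite mnmDE mnmDE !mulmnE !mnmE.
  have := su i; have := tv i; rewrite cs ct BE.
  by case: (i \in N); case: (i \in A) => //=; rewrite ?mul0n ?mul1n; lia.
move=> d e u v [s [sd sM] su] [t [te tM] tv] uv.
have [|C|i|B] := H (s ++ t) (d + e).+1.
- by rewrite size_cat sd te addnS.
- by rewrite mem_cat => /orP[/sM|/tM].
- have /mnmP/(_ i) := uv; rewrite mnmDE mnmDE mulmnE !mnmE => <-.
  by rewrite count_cat leq_add.
rewrite mem_cat => /orP[sB|tB] BA.
  by right; apply: (half d e u v s t B).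
left; apply: (half e d v u t s B) => //.
by rewrite addmC uv addnC.
Qed.

(** A has only i outside N, so any factor other than N agrees with it there. If all m + 1 factors
    were N, the exponents would force N inside A. *)
Lemma mset_setU1_indecomposable A i :
    min_nonface D A -> A <> N -> A \subset i |: N ->
  indecomposable D N (mset A).
Proof.
move=> AM AN Ai; apply: mset_indecomposable => // s m sm sM sA.
have [j jA jN] := min_nonfaceNsub AM AN.
have Aoff l : l \in A -> l \notin N -> l = i.
  by move=> /(subsetP Ai); rewrite !inE => /orP[/eqP//|->].
have [sN|/existsNP[B /not_implyP[sB BN]]] := pselect (forall B, B \in s -> B = N).
  case: AN; apply: esym; apply: (min_nonface_eq AM (min_nonfaceE NM)).
  apply/subsetP => l lN; have := sA l;
    rewrite (count_constN (N := N)) // sm lN !mul1n.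
  by case: (l \in A) => //; rewrite addn0 ltnn.
exists B => //.
have BA l : l \in B -> l \notin N -> l \in A.
  move=> lB lN; have := sA l; have := cnt_gt0 sB lB.
  by rewrite (negPf lN) mul0n add0n; case: (l \in A) => //; case: (cnt l s).
have [b bB bN] := min_nonfaceNsub (sM _ sB) BN.
have bi := Aoff _ (BA _ bB bN) bN.
apply/setP => l; rewrite !inE; case: (boolP (l \in N)) => //= lN.
apply/idP/idP => [lB|lA]; first exact: BA.
by rewrite (Aoff _ lA lN) -bi.
Qed.

(** This monomial stands for x_i itself. All factors are N, so the excesses of u and v over copies
    of N add up to one unit vector, and one of them is 0. *)
Lemma msetU_indecomposable i :
  (forall A, min_nonface D A -> A \subset i |: N -> A = N) ->
  indecomposable D N (G + U_(i)).
Proof.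
move=> H; split.
- by apply/eqP => /mnmP/(_ i); rewrite mnmDE mnm1E eqxx; lia.
- apply: (cover1 (min_nonfaceE NM)) => j jN.
  by rewrite mnmDE mnmE jN.
move=> d e u v [s [sd sM] su] [t [te tM] tv] /mnmP uv.
have sN C : C \in s ++ t -> C = N.
  move=> HC; apply: H; first by move: HC; rewrite mem_cat => /orP[/sM|/tM].
  apply/subsetP => j jC; rewrite !inE; have := uv j.
  rewrite !mnmDE mulmnE mnm1E !mnmE (eq_sym i j).
  have := cnt_gt0 HC jC; rewrite count_cat; have := su j; have := tv j.
  by case: (j \in N); case: (j == i) => //=; rewrite ?mul0n; lia.
have cs j : (((j \in N) * d.+1)%N <= u j)%N.
  rewrite -sd -(count_constN (N := N)); first exact: su.
  by move=> C HC; apply: sN; rewrite mem_cat HC.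
have ct j : (((j \in N) * e.+1)%N <= v j)%N.
  rewrite -te -(count_constN (N := N)); first exact: tv.
  by move=> C HC; apply: sN; rewrite mem_cat HC orbT.
have E j : (u j + v j = (j \in N) * d.+1 + (j \in N) * e.+1 + (j == i))%N.
  have := uv j; rewrite !mnmDE mulmnE mnm1E !mnmE (eq_sym i j) => ->.
  by case: (j \in N); case: (j == i) => /=; rewrite ?mul0n ?mul1n; lia.
have [Eu|/eqP nEu] := eqVneq (u i) ((i \in N) * d.+1)%N; [left|right];
  apply/mnmP => j;
  rewrite mulmnE mnmE; have := E j; have := cs j; have := ct j;
  case: (j =P i) => [->|_]; rewrite ?addn0 ?Eu /=.
- by [].
- by case: (j \in N); rewrite ?mul0n ?mul1n; lia.
- by move: nEu; case: (i \in N); rewrite ?mul0n ?mul1n; lia.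
by case: (j \in N); rewrite ?mul0n ?mul1n; lia.
Qed.

Hypothesis bound : forall r (W : 'I_r -> 'X_{1..n}), injective W ->
  (forall i, indecomposable D N (W i)) -> (r <= n)%N.

(* The n indecomposable monomials f i exhaust the bound, so there are no others. *)
Lemma indecomposable_off : exists f : 'I_n -> 'X_{1..n}, forall w,
  indecomposable D N w ->
  exists2 i, w = f i & forall j, j \notin N -> w j = (j == i).
Proof.
(* The monomial attached to i: x_A / x_N if N with i added contains another minimal nonface A, and
   x_i otherwise; the latter always holds for i in N. *)
have /choice[f Hf] : forall i, exists v, [/\ indecomposable D N v,
    forall j, j \notin N -> v j = (j == i) & i \in N -> v = (G + U_(i))%MM].
  move=> i.
  have [[A [AM AN Ai]]|nA] := pselect (exists A, [/\ min_nonface D A,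
    A <> N & A \subset i |: N]).
    exists (mset A); split; first exact: (mset_setU1_indecomposable AM AN Ai).
      move=> j jN; rewrite mnmE; congr (nat_of_bool _).
      have [a aA aN] := min_nonfaceNsub AM AN.
      have Aoff l : l \in A -> l \notin N -> l = i.
        by move=> /(subsetP Ai); rewrite !inE => /orP[/eqP//|->].
      apply/idP/eqP => [jA|->]; first exact: Aoff.
      by rewrite -(Aoff _ aA aN).
    move=> iN; case: AN; apply: (min_nonface_subE NM AM).
    by apply: subset_trans Ai _; rewrite subUset sub1set iN subxx.
  exists (G + U_(i))%MM; split=> //.
    apply: msetU_indecomposable => A AM Ai; apply: contrapT => AN.
    by apply: nA; exists A.
  by move=> j jN; rewrite mnmDE mnm1E mnmE (negPf jN) (eq_sym i j).
have f_inj : injective f.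
  move=> i j E; have [Ii offi fi] := Hf i; have [Ij offj fj] := Hf j.
  case: (boolP (i \in N)) => iN; last first.
    have := offi _ iN; rewrite eqxx E offj //.
    by case: eqP.
  case: (boolP (j \in N)) => jN; last first.
    have := offj _ jN; rewrite eqxx -E offi //.
    by case: eqP.
  have /mnmP/(_ i) := E; rewrite fi // fj // !mnmDE !mnm1E eqxx => /addnI.
  by case: (j =P i).
exists f => w Iw; apply: contrapT => now.
have wf i : f i <> w.
  by move=> E; apply: now; exists i => // j jN; rewrite -E; have [_ -> ] := Hf i.
have := @bound n.+1 (fun i => oapp f w (unlift ord_max i)).
rewrite ltnn => H; suff: false by []; apply: H.
  move=> i j; case: (unliftP ord_max i) => [i'|] ->;
    case: (unliftP ord_max j) => [j'|] -> //=.
  - by move/f_inj ->.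
  - by move/wf.
  - by move/esym/wf.
by move=> i; case: (unliftP ord_max i) => [i' _|_] //=; case: (Hf i').
Qed.

End Indecomposables.

(** * The matroid of minimal nonfaces *)

Section Exchange.
Variables (n : nat) (D : {set {set 'I_n}}).
Hypothesis Dsc : simplicial_complex D.
Hypothesis bound : forall N, min_nonface D N -> forall r (W : 'I_r -> 'X_{1..n}),
  injective W -> (forall i, indecomposable D N (W i)) -> (r <= n)%N.
Implicit Types (A B F N : {set 'I_n}).

Lemma mset_off N A : min_nonface D N -> indecomposable D N (mset A) ->
  exists i, forall j, j \notin N -> (j \in A) = (j == i).
Proof.
move=> NM IA; have [f /(_ _ IA)[i _ Hi]] := indecomposable_off NM (bound NM).
by exists i => j /Hi; rewrite mnmE; case: (j \in A); case: (j == i).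
Qed.

Lemma mset_off_inj N A B l : min_nonface D N ->
    indecomposable D N (mset A) -> indecomposable D N (mset B) ->
    l \notin N -> l \in A -> l \in B -> A = B.
Proof.
move=> NM IA IB lN lA lB; have [f Hf] := indecomposable_off NM (bound NM).
have [i Ei Hi] := Hf _ IA; have [j Ej Hj] := Hf _ IB.
have il : l = i by have := Hi l lN; rewrite mnmE lA; case: eqP.
have jl : l = j by have := Hj l lN; rewrite mnmE lB; case: eqP.
have /mnmP E : mset A = mset B by rewrite Ei Ej -il -jl.
by apply/setP => b; have := E b; rewrite !mnmE; case: (b \in A); case: (b \in B).
Qed.

(* If no exchange were possible, a minimal nonface A avoiding j and all the l that
   can replace j, with A \ N as small as possible, would be a further
   indecomposable monomial. *)
Lemma exchange N N' j : min_nonface D N -> min_nonface D N' -> j \in N ->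
    j \notin N' ->
  exists2 l, l \in N' :\: N & l |: N :\ j \notin D.
Proof.
move=> NM N'M jN jN'; apply: contrapT => /forall2NP nl.
pose X := [set l | (l \notin N) && (l |: N :\ j \notin D)].
pose fam A := [&& min_nonface D A, j \notin A & [disjoint A & X]].
have famN' : fam N'.
  rewrite /fam N'M jN'; rewrite disjoints_subset; apply/subsetP => l lN'.
  rewrite !inE negb_and !negbK; case: (boolP (l \in N)) => //= lN.
  by have [|/negP] := nl l; rewrite ?inE ?lN' ?lN // negbK.
case: (arg_minnP (fun A => #|A :\: N|) famN') => A /and3P[AM jA AX] Amin.
have AN : A <> N by move=> E; rewrite E jN in jA.
have IA : indecomposable D N (mset A).
  apply: (mset_indecomposable NM AM AN) => s m sm sM sA.
  (* There are m + 1 factors, while x_j has exponent only m in x_N^m x_A. *)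
  have [B sB jB] : exists2 B, B \in s & j \notin B.
    apply: contrapT => /forall2NP H; have := sA j;
      rewrite jN mul1n (negPf jA) addn0.
    suff -> : count (fun A => j \in A) s = size s by rewrite sm ltnn.
    apply/eqP; rewrite -all_count; apply/allP => B sB.
    by have [//|/negP] := H B; rewrite negbK.
  exists B => //.
  have BA : B :\: N \subset A :\: N.
    apply/subsetP => l; rewrite !inE => /andP[lN lB]; rewrite lN /=.
    have := sA l; have := cnt_gt0 sB lB.
    by rewrite (negPf lN) mul0n add0n; case: (l \in A) => //; case: (count _ s).
  apply/eqP; rewrite eqEcard BA; apply: Amin.
  rewrite /fam sM // jB disjoints_subset; apply/subsetP => l lB; rewrite inE.
  apply/negP => lX; have := lX; rewrite inE => /andP[lN _].
  have lA : l \in A by have /subsetP/(_ l) := BA; rewrite !inE lN lB => /(_ isT).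
  by rewrite (disjointFr AX lA) in lX.
have [l Al] := mset_off NM IA.
have [a aA aN] := min_nonfaceNsub NM AM AN.
have al : a = l by apply/eqP; rewrite -(Al _ aN).
(* A has a single element l outside N and avoids j, so it is contained in N with j replaced by l.
   This puts l in X, which A was to avoid. *)
have lX : l \in X.
  rewrite inE -al aN /=; apply: (nonface_sub Dsc _ (min_nonfaceE AM)).
  apply/subsetP => b bA; rewrite !inE; case: (boolP (b \in N)) => bN.
    by rewrite andbT; apply/orP; right; apply: contraNneq jA => <-.
  by rewrite andbF orbF; have := Al _ bN; rewrite bA al => <-.
by move: lX; rewrite -al (disjointFr AX aA).
Qed.

(** Exchanging an element of N for one of N' does not increase the size and brings N closer to N';
    induction on the size of N minus N'. *)
Lemma min_nonface_card_leq N N' : min_nonface D N -> min_nonface D N' ->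
  (#|N'| <= #|N|)%N.
Proof.
have [m] := ubnP #|N :\: N'|; elim: m N => // m IH N; rewrite ltnS => Nm NM N'M.
have [NN'|/subsetPn[j jN jN']] := boolP (N \subset N').
  by rewrite (min_nonface_subE N'M NM NN').
have [l lN' ND] := exchange NM N'M jN jN'.
move: lN'; rewrite inE => /andP[lN lN'].
have [M MM Ml] := ex_min_nonface ND.
apply: (@leq_trans #|M|).
  apply: IH => //; apply: leq_trans Nm; apply: proper_card; apply/properP; split.
    apply/subsetP => b; rewrite !inE => /andP[bN' /(subsetP Ml)].
    rewrite !inE => /orP[/eqP bl|/andP[_ ->]]; last by rewrite bN'.
    by rewrite bl lN' in bN'.
  exists j; rewrite !inE ?jN ?jN' //.
  apply/negP => /(subsetP Ml); rewrite !inE eqxx /= orbF => /eqP jl.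
  by rewrite jl (negPf lN) in jN.
apply: leq_trans (subset_leq_card Ml) _.
by rewrite cardsU1 (cardsD1 j N) jN !inE (negPf lN) andbF.
Qed.

(** Minimal nonfaces are equicardinal, and the exchanged set has the size of N. *)
Lemma exchange_min N l j : min_nonface D N -> j \in N -> l \notin N ->
  l |: N :\ j \notin D -> min_nonface D (l |: N :\ j).
Proof.
move=> NM jN lN ND; have [M MM Ml] := ex_min_nonface ND.
suff -> : l |: N :\ j = M by [].
apply/esym/eqP; rewrite eqEcard Ml.
apply: leq_trans (min_nonface_card_leq MM NM).
by rewrite cardsU1 (cardsD1 j N) jN !inE (negPf lN) andbF.
Qed.

(** The bound on fundamental circuits: two different exchanges bringing in l would be two
    indecomposables with the same part l outside N. *)
Lemma swap_at_most_one N l s t : min_nonface D N -> l \notin N -> s \in N ->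
  t \in N ->
  l |: N :\ s \notin D -> l |: N :\ t \notin D -> s = t.
Proof.
move=> NM lN sN tN sD tD.
have key j : j \in N -> l |: N :\ j \notin D -> indecomposable D N (mset (l |: N
  :\ j)).
  move=> jN jD; apply: (mset_setU1_indecomposable NM (i := l)).
  - exact: exchange_min.
  - move=> /setP/(_ j); rewrite !inE eqxx jN orbF => /eqP jl.
    by rewrite -jl jN in lN.
  by apply: setUS; apply: subD1set.
apply/eqP; apply: contraT => st.
have E := mset_off_inj NM (key s sN sD) (key t tN tD) lN (setU11 _ _) (setU11 _ _).
move/setP/(_ t): E; rewrite !inE eqxx tN andbT orbF (eq_sym t s) st orbT =>
  /esym/eqP tl.
by rewrite tl (negPf lN) in tN.
Qed.

Lemma facet_setU1_nonface F i : facet D F -> i \notin F -> i |: F \notin D.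
Proof.
move=> /maxsetP[_ Fmax] iF; apply/negP => iFD.
by have /setP/(_ i) := Fmax _ iFD (subsetUr _ _); rewrite !inE eqxx (negPf iF).
Qed.

Lemma ex_min_nonface_facet F i : facet D F -> i \notin F ->
  exists2 N, min_nonface D N & N :\: F = [set i].
Proof.
move=> FF iF; have [N NM NF] := ex_min_nonface (facet_setU1_nonface FF iF).
have NFi j : j \in N -> j \notin F -> j = i.
  by move=> /(subsetP NF); rewrite !inE => /orP[/eqP//|->].
have [j jN jF] := nonfaceP Dsc (min_nonfaceE NM) FF.
exists N => //; apply/setP => l; rewrite !inE; apply/andP/eqP => [[lF lN]|->].
  exact: NFi.
by rewrite iF -(NFi j jN jF).
Qed.

(** Indices outside F are parallel. Exchange i against a minimal nonface that leaves F only at s: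
    the new element must lie outside F, otherwise the result is a face, so it is s. *)
Lemma swap_off_facet F N i s : facet D F -> min_nonface D N -> N :\: F = [set i] ->
  s \notin F -> s != i -> s |: N :\ i \notin D.
Proof.
move=> FF NM NF sF si; have [N' N'M N'F] := ex_min_nonface_facet FF sF.
have : i \in N :\: F by rewrite NF set11.
rewrite inE => /andP[iF iN].
have iN' : i \notin N'.
  apply/negP => iN'; have : i \in N' :\: F by rewrite inE iF.
  by rewrite N'F inE eq_sym (negPf si).
have [l lN' lD] := exchange NM N'M iN iN'.
suff <- : l = s by [].
have lF : l \notin F.
  apply: contra lD => lF; apply: (face_sub Dsc) (facet_face FF).
  apply/subsetP => b; rewrite !inE => /orP[/eqP->//|/andP[bi bN]].
  by apply: contraT => bF; have /setP/(_ b) := NF; rewrite !inE bF bN (negPf bi).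
by have /setP/(_ l) := N'F; move: lN'; rewrite !inE lF => /andP[_ ->] /esym/eqP.
Qed.

(** Exchange s for some l in F. By induction the new set M leaves F only at i; then s could replace
    both i, which is parallel to it, and l, which restores N, against [swap_at_most_one]. *)
Lemma min_nonface_facet_uniq F N i s : facet D F -> min_nonface D N ->
  i \in N :\: F -> s \in N :\: F -> i = s.
Proof.
move=> FF; have [m] := ubnP #|N :\: F|; elim: m N i s => // m IH N i s;
  rewrite ltnS => Nm NM iNF sNF.
apply/eqP; apply: contraT => is_.
have := iNF; have := sNF; rewrite !inE => /andP[sF sN] /andP[iF iN].
have [N1 N1M N1F] := ex_min_nonface_facet FF iF.
have N1off b : b \in N1 -> b \notin F -> b = i.
  by move=> bN bF; have /setP/(_ b) := N1F; rewrite !inE bN bF => /esym/eqP.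
have sN1 : s \notin N1.
  by apply/negP => /N1off-/(_ sF) E; rewrite E eqxx in is_.
have [l] := exchange NM N1M sN sN1; rewrite inE => /andP[lN lN1] lD.
have lF : l \in F.
  by apply: contraT => lF; rewrite (N1off l lN1 lF) iN in lN.
have MM := exchange_min NM sN lN lD; set M := l |: N :\ s in lD MM.
have MF : M :\: F = (N :\: F) :\ s.
  apply/setP => b; rewrite !inE; case: (b =P l) => [->|_] /=;
    first by rewrite lF andbF.
  by case: (b == s); rewrite ?andbF ?andbT.
have iM : i \in M :\: F by rewrite MF !inE is_ iF iN.
have Mi : M :\: F = [set i].
  apply/setP => b; rewrite in_set1; apply/idP/eqP => [bM|-> //].
  apply: (IH M b i) => //; apply: leq_trans Nm; rewrite MF.
  by rewrite [X in (_ < X)%N](cardsD1 s) sNF.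
have sM : s \notin M.
  rewrite !inE eqxx orbF; apply/eqP => sl; by rewrite sl lF in sF.
have sMi := swap_off_facet FF MM Mi sF _; rewrite eq_sym in is_.
have sMl : s |: M :\ l \notin D.
  suff -> : s |: M :\ l = N by exact: min_nonfaceE.
  apply/setP => b; rewrite !inE; case: (b =P s) => [->|bs] //=.
  by case: (b =P l) => [->|_] //=; rewrite (negPf lN).
have := swap_at_most_one MM sM _ _ (sMi is_) sMl.
rewrite setU11 => il; have {}il : i = l.
  by apply: il => //; move: iM; rewrite inE => /andP[].
by rewrite -il (negPf iF) in lF.
Qed.

(** If i is missed by both, some minimal nonface N leaves F, and then also G, exactly at i. An a in
    G outside F may replace i in N, yet the result is contained in the face G. *)
Lemma facets_cover F G : facet D F -> facet D G -> F <> G -> F :|: G = [set: 'I_n].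
Proof.
move=> FF GG FG; apply/setP => i; rewrite in_setT; apply: contraT.
rewrite inE negb_or => /andP[iF iG].
have [N NM NF] := ex_min_nonface_facet FF iF.
have iN : i \in N by have /setP/(_ i) := NF; rewrite !inE eqxx => /andP[].
have NG : N :\: G = [set i].
  apply/setP => b; rewrite in_set1; apply/idP/eqP => [bN|->];
    last by rewrite inE iG.
  by apply: (min_nonface_facet_uniq GG NM bN); rewrite inE iG.
have [a aG aF] : exists2 a, a \in G & a \notin F.
  apply/subsetPn; apply: contra_notN FG => GF.
  by have /maxsetP[_ Gmax] := GG; apply: Gmax (facet_face FF) GF.
have ai : a != i by apply: contraTneq aG => ->.
case/negP: (swap_off_facet FF NM NF aF ai).
apply: (face_sub Dsc) (facet_face GG); apply/subsetP => b.
rewrite !inE => /orP[/eqP->//|/andP[bi bN]].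
by apply: contraT => bG; have /setP/(_ b) := NG; rewrite !inE bG bN (negPf bi).
Qed.

End Exchange.

Theorem proposition2p11 (k : closedFieldType) (n : nat)
    (I : {pred {mpoly k[n]}}) (Delta : {set {set 'I_n}})
    (hI : squarefree_monomial_ideal I)
    (hDelta : simplicial_complex Delta)
    (hID : stanley_reisner k Delta =i I) :
  tame I <->
  (forall F G : {set 'I_n}, facet Delta F -> facet Delta G -> F <> G ->
     F :|: G = [set: 'I_n]).
Proof.
have {hI hID} -> : I = stanley_reisner k Delta by apply: funext => f;
  rewrite -[LHS]hID.
split=> [It F G|disj P].
  apply: (facets_cover hDelta) => N NM r W W_inj WI.
  exact: vertex_regular_bound (It (vertex_pt k NM)) W_inj WI.
have [N NM oN] := ex_min_nonface_out P.
exact: chart_regular disj P N NM oN.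
Qed.
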